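(* Let $h$ be a convex normal integrand on $\mathbb{R}^n\times\Omega$ and define on $L^\infty$ the functions $\phi(z)=\inf_{x\in\mathcal N}Eh(x+z)$ and $\tilde\phi(z)=\inf_{x\in\mathcal N^\infty}Eh(x+z)$. Assume that $\phi(0)$ is finite and $Eh$ is proper on $L^\infty$, and that for every $z\in\operatorname{dom}Eh\cap L^\infty$ and every $t=0,\ldots,T$ there exists $\hat z\in\operatorname{dom}Eh\cap L^\infty$ such that $E_tz^t=\hat z^t$. (i) If $\tilde\phi$ is proper and strongly closed at the origin, then $\phi$ is closed at the origin and $\phi(0)=(\operatorname{cl}\tilde\phi)(0)$. (ii) If $\tilde\phi$ is strongly subdifferentiable at the origin, then $\partial\phi(0)=\partial\tilde\phi(0)\ne\emptyset$.
   Context: $(\Omega,\mathcal F,P)$ is a probability space with a filtration $(\mathcal F_t)_{t=0}^T$ (sub-$\sigma$-algebras of $\mathcal F$; $\mathcal F_T$ need not equal $\mathcal F$), and $n=n_0+\cdots+n_T$. $L^p:=L^p(\Omega,\mathcal F,P;\mathbb{R}^n)$ for $p\in\{0,1,\infty\}$. $\mathcal N=\{(x_t)_{t=0}^T \mid x_t\in L^0(\Omega,\mathcal F_t,P;\mathbb{R}^{n_t})\}$ and $\mathcal N^\infty:=\mathcal N\cap L^\infty$. For $x=(x_0,\ldots,x_T)$, $x^t:=(x_0,\ldots,x_t)$. $E_t$ is the conditional expectation with respect to $\mathcal F_t$. A normal integrand is a function $h:\mathbb{R}^n\times\Omega\to[-\infty,\infty]$ such that $\omega\mapsto\{(\xi,\alpha)\mid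 h(\xi,\omega)\le\alpha\}$ is a closed-valued $\mathcal F$-measurable set-valued mapping; it is convex if $h(\cdot,\omega)$ is convex for every $\omega$. For $x\in L^0$, $Eh(x)$ is the expectation of $\omega\mapsto h(x(\omega),\omega)$, where the expectation of a measurable function is defined as $+\infty$ unless its positive part is integrable. $\operatorname{dom}Eh=\{x\mid Eh(x)<\infty\}$. A function is proper if it never takes the value $-\infty$ and is not identically $+\infty$; ''$Eh$ is proper on $L^\infty$'' refers to its restriction to $L^\infty$. Conjugates, closures and subdifferentials without the word ''strong'' are with respect to the pairing $\langle z,v\rangle=E(z\cdot v)$ of $L^\infty$ with $L^1$: for $f:L^\infty\to[-\infty,\infty]$, $f^*(v)=\sup_{z\in L^\infty}\{\langle z,v\rangle-f(z)\}$ for $v\in L^1$, $\operatorname{cl}f:=f^{**}$, i.e. $(\operatorname{cl}f)(z)=\sup_{v\in L^1}\{\langle z,v\rangle-f^*(v)\}$; $f$ is closed at the origin if $f(0)=(\operatorname{cl}f)(0)$; and $\partial f(0)=\{v\in L^1\mid f(z)\ge f(0)+\langle z,v\rangle\ \forall z\in L^\infty\}$ (empty unless $f(0)$ is finite). The ''strong'' notions are the same ones with $L^1$ replaced by the Banach dual $(L^\infty)^*$ of $L^\infty$ with its norm topology: $f$ is strongly closed at the origin if $f(0)$ equals the value at $0$ of its biconjugate with respect to the pairing of $L^\infty$ with $(L^\infty)^*$, and $f$ is strongly subdifferentiable at the origin if $f(0)$ is finite and there is $v\in(L^\infty)^*$ with $f(z)\ge f(0)+v(z)$ for all $z\in L^\infty$.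 *)

(* Defs.v *)
From HB Require Import structures.
From mathcomp Require Import all_boot all_order all_algebra.
From mathcomp Require Import all_classical all_reals all_analysis.

Set Implicit Arguments.
Unset Strict Implicit.
Unset Printing Implicit Defensive.
Import Order.TTheory GRing.Theory Num.Theory.
Import numFieldNormedType.Exports.
Local Open Scope classical_set_scope.
Local Open Scope ring_scope.

(** Elements of the spaces L^p are represented by functions. For L0 over a
    sub-sigma-algebra, [L0 G] consists of the genuinely [G]-measurable
    representatives, so that a class belongs to L^0(G) iff one of its members is
    in [L0 G]. *)
Section spaces.
Context {d : measure_display} {Omega : measurableType d} {R : realType}.
Variable P : probability Omega R.

(** Measurability with respect to [G] of an R^m-valued function, expressed
    coordinatewise. *)
Definition L0 (G : set (set Omega)) (m : nat) : set (Omega -> 'rV[R]_m) :=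
  [set x | forall (i : 'I_m) (B : set R), measurable B ->
     G ((fun w => x w 0 i) @^-1` B)].

(** [`|x w|] is the max norm on R^m; any other norm on R^m gives the same
    spaces and an equivalent norm. *)
Definition LpNorm (p : \bar R) (m : nat) (x : Omega -> 'rV[R]_m) : \bar R :=
  Lnorm P p (fun w => `|x w|%:E).

Definition Lp (p : \bar R) (m : nat) : set (Omega -> 'rV[R]_m) :=
  [set x | L0 (@measurable d Omega) x /\ (LpNorm p x < +oo)%E].

(** The Banach dual of [Lp +oo m]; only the values on [Lp +oo m] matter. *)
Definition Linf_dual (m : nat) : set ((Omega -> 'rV[R]_m) -> R) :=
  [set v | (forall (a : R) (x y : Omega -> 'rV[R]_m),
              Lp +oo%E x -> Lp +oo%E y -> v (a *: x + y) = a * v x + v y) /\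
           (exists C : R, forall x : Omega -> 'rV[R]_m,
              Lp +oo%E x -> (`|v x|%:E <= C%:E * LpNorm +oo%E x)%E)].

Definition pairing (m : nat) (z v : Omega -> 'rV[R]_m) : R :=
  \int[P]_w (\sum_(i < m) z w 0 i * v w 0 i).

(** E[x | G] = y in L^1: y agrees a.s. with a version of the conditional
    expectation. *)
Definition condexp_eq (G : set (set Omega)) (m : nat)
    (x y : Omega -> 'rV[R]_m) : Prop :=
  exists y' : Omega -> 'rV[R]_m,
    [/\ L0 G y', Lp 1%E y',
        forall (A : set Omega) (i : 'I_m), G A ->
          (\int[P]_(w in A) (y' w 0 i)%:E = \int[P]_(w in A) (x w 0 i)%:E)%E
      & {ae P, forall w, y w = y' w}].

(** The library's integral is -oo when both parts have infinite integral. *)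
Definition expect (f : Omega -> \bar R) : \bar R :=
  (if \int[P]_w (f^\+ w) < +oo then \int[P]_w f w else +oo)%E.

End spaces.
Arguments L0 {d Omega R} G {m}.
Arguments Lp {d Omega R} P p {m}.
Arguments Linf_dual {d Omega R} P {m}.
Arguments pairing {d Omega R} P {m}.

Section duality.
Context {R : realType} {X : zmodType} {Y : Type}.
Variables (D : set X) (V : set Y) (pair : X -> Y -> R).
Implicit Type f : X -> \bar R.
Local Open Scope ereal_scope.

Definition proper_on f : Prop :=
  (forall z, D z -> f z != -oo) /\ (exists2 z, D z & f z != +oo).

Definition conjugate f (v : Y) : \bar R :=
  ereal_sup [set (pair z v)%:E - f z | z in D].

Definition biconjugate f (z : X) : \bar R :=
  ereal_sup [set (pair z v)%:E - conjugate f v | v in V].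

Definition closed_at0 f : Prop := f 0%R = biconjugate f 0%R.

Definition subdiff0 f : set Y :=
  [set v | [/\ V v, f 0%R \is a fin_num
             & forall z, D z -> f 0%R + (pair z v)%:E <= f z]].

End duality.

Section integrands.
Context {d : measure_display} {Omega : measurableType d} {R : realType}.
Variable m : nat.
Implicit Type h : 'rV[R]_m -> Omega -> \bar R.

Definition epi h (w : Omega) : set ('rV[R]_m * R) :=
  [set p | (h p.1 w <= p.2%:E)%E].

Definition normal_integrand h : Prop :=
  (forall w, closed (epi h w)) /\
  (forall O : set ('rV[R]_m * R), open O ->
     measurable [set w | epi h w `&` O !=set0]).

(** Convexity of an extended-real-valued function is that of its epigraph. *)
Definition convex_integrand h : Prop :=
  forall w, @convex_set R ('rV[R]_m * R)%type (epi h w).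

Definition Eh (P : probability Omega R) h (x : Omega -> 'rV[R]_m) : \bar R :=
  expect P (fun w => h (x w) w).

End integrands.

Section problem.
Context {d : measure_display} {Omega : measurableType d} {R : realType}.
Variables (P : probability Omega R) (T : nat) (n : 'I_T.+1 -> nat).
Variable F : 'I_T.+1 -> set (set Omega).
Local Notation N := (\sum_(t < T.+1) n t)%N.

Definition filtration : Prop :=
  [/\ forall t, sigma_algebra setT (F t),
      forall t, F t `<=` measurable
    & forall s t : 'I_T.+1, (s <= t)%N -> F s `<=` F t].

(** x_t, for x = (x_0, ..., x_T). *)
Definition block (x : Omega -> 'rV[R]_N) (t : 'I_T.+1) : Omega -> 'rV[R]_(n t) :=
  fun w => submxrow (x w) t.

Definition adapted : set (Omega -> 'rV[R]_N) :=
  [set x | forall t, L0 (F t) (block x t)].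

Definition adapted_inf : set (Omega -> 'rV[R]_N) :=
  adapted `&` Lp P +oo%E.

Definition phi (h : 'rV[R]_N -> Omega -> \bar R) (z : Omega -> 'rV[R]_N) :
    \bar R := ereal_inf [set Eh P h (x + z) | x in adapted].

Definition phi_tilde (h : 'rV[R]_N -> Omega -> \bar R)
    (z : Omega -> 'rV[R]_N) : \bar R :=
  ereal_inf [set Eh P h (x + z) | x in adapted_inf].

End problem.
Arguments adapted {d Omega R T n} F.
Arguments adapted_inf {d Omega R} P {T n} F.
Arguments phi {d Omega R} P {T n} F h.
Arguments phi_tilde {d Omega R} P {T n} F h.

Section dualities_Linf.
Context {d : measure_display} {Omega : measurableType d} {R : realType}.
Variables (P : probability Omega R) (m : nat).
Implicit Type f : (Omega -> 'rV[R]_m) -> \bar R.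

Local Notation Linf := (@Lp d Omega R P +oo%E m).
Local Notation L1 := (@Lp d Omega R P 1%E m).

Definition eval_pairing (z : Omega -> 'rV[R]_m) (v : (Omega -> 'rV[R]_m) -> R) : R :=
  v z.

Definition cl f : (Omega -> 'rV[R]_m) -> \bar R :=
  biconjugate Linf L1 (pairing P) f.

Definition closed_origin f : Prop := closed_at0 Linf L1 (pairing P) f.

Definition subdiff_origin f : set (Omega -> 'rV[R]_m) :=
  subdiff0 Linf L1 (pairing P) f.

Definition strongly_closed_origin f : Prop :=
  closed_at0 Linf (Linf_dual P) eval_pairing f.

Definition strongly_subdifferentiable_origin f : Prop :=
  subdiff0 Linf (Linf_dual P) eval_pairing f !=set0.

End dualities_Linf.

(* Main.v *)
Require Import Defs.
From HB Require Import structures.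
From mathcomp Require Import all_boot all_order all_algebra.
From mathcomp Require Import all_classical all_reals all_analysis.
From mathcomp Require Import measurable_realfun ess_sup_inf ring lra.
Set Implicit Arguments.
Unset Strict Implicit.
Unset Printing Implicit Defensive.
Import Order.TTheory GRing.Theory Num.Theory.
Import numFieldNormedType.Exports.
Local Open Scope classical_set_scope.
Local Open Scope ring_scope.

(** Let [v] be a strong dual element with [v z - c <= phi_tilde z] for all [z]. Then [v]
    vanishes on the bounded adapted processes and [v z - c <= Eh z]. By Yosida-Hewitt, each
    coordinate of [v] is an L^1 density plus a part carried by sets of arbitrarily small
    probability; gluing [z] off such a set with another point [z'] of dom Eh on it shows that
    the singular part may be evaluated at [z'] while the rest stays at [z]. Going backwards
    in time, take for [z'] the point [zhat] with [zhat^t = E_t z^t]: the time-[t] singular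
    part composed with [E_t] is the L^1 functional given by minus the conditional
    expectation of the density, because [v] vanishes on adapted processes; for the earlier
    times the compositions with [E_t] are decomposed again. After time 0 only a density [p]
    in L^1, orthogonal to the bounded adapted processes, is left, with the same constant
    [c]. Truncation replaces bounded adapted processes by arbitrary ones, so
    [E(z . p) - c <= phi z], and both claims follow by comparing [phi] and [phi_tilde]. *)

(** The dual of L^infty contains functionals that are only finitely additive, so the strong
    hypotheses give no density by themselves. The task is to turn an affine minorant into one with a
    density without any loss in [c]; each gluing costs an integral over a set of arbitrarily small
    probability, and nothing remains of this cost in the limit. The backward order is forced by the
    hypothesis on conditional expectations: it controls [zhat] up to time [t] only, and the later
    values of [zhat] are harmless because the singular parts of those times are already gone.
    Passing to unbounded adapted [x] is more than a density argument: [x . p] need not be integrable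
    a priori, and the only control is one-sided, coming from [Eh (x + z) < +oo] and the minorant
    itself. Since dual elements act on classes while gluing and truncation act pointwise, the
    argument works with representatives bounded everywhere. The constant [c] is the conjugate of
    [phi_tilde] at [v] for the first claim and [- phi_tilde 0] for the second. *)

Section integrable_functions.
Context {d : measure_display} {Omega : measurableType d} {R : realType}.
Variable P : probability Omega R.
Implicit Types (u f g : Omega -> R) (A : set Omega).
Local Notation L1 u := (P.-integrable setT (EFin \o u)).
Local Notation E u := (Rintegral P setT u).

(** * Calculus of real-valued integrable functions and absolute continuity of the integral *)

Lemma L1_measurable u : L1 u -> measurable_fun setT u.
Proof. by move=> /measurable_int /measurable_EFinP. Qed.

Lemma L1_le u f : measurable_fun setT f -> L1 u ->
  (forall w, `|f w| <= u w) -> L1 f.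
Proof.
move=> mf iu fu; apply: le_integrable iu => //; first exact/measurable_EFinP.
by move=> w _ /=; rewrite lee_fin (le_trans (fu w))// ler_norm.
Qed.

Lemma L1D u f : L1 u -> L1 f -> L1 (fun w => u w + f w).
Proof. by move=> iu jf; exact: (integrableD measurableT iu jf). Qed.

Lemma L1Z (a : R) u : L1 u -> L1 (fun w => a * u w).
Proof. by move=> iu; exact: (integrableZl measurableT a iu). Qed.

Lemma L1B u f : L1 u -> L1 f -> L1 (fun w => u w - f w).
Proof. by move=> iu jf; exact: (integrableB measurableT iu jf). Qed.

Lemma L1_sum (I : Type) (s : seq I) (p : pred I) (u : I -> Omega -> R) :
  (forall i, L1 (u i)) -> L1 (fun w => \sum_(i <- s | p i) u i w).
Proof.
move=> iu; have H := integrable_sum measurableT s (P := p) (mu := P)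
  (h := fun i => EFin \o u i) (fun i _ => iu i).
 apply: eq_integrable H => // w _ /=.
by rewrite sumEFin.
Qed.

Lemma L1_norm u : L1 u -> L1 (fun w => `|u w|).
Proof. exact: integrable_norm. Qed.

Lemma L1_bounded f (M : R) : measurable_fun setT f -> (forall w, `|f w| <= M) -> L1 f.
Proof.
move=> mf fM; apply: (L1_le (u := cst M)) => //.
exact: finite_measure_integrable_cst.
Qed.

Lemma L1_mul u f (M : R) : L1 u -> measurable_fun setT f -> (forall w, `|f w| <= M) ->
  L1 (fun w => u w * f w).
Proof.
move=> iu mf fM; apply: (L1_le (u := fun w => M * `|u w|)).
- by apply: measurable_funM => //; exact: L1_measurable.
- exact/L1Z/L1_norm.
- by move=> w; rewrite normrM mulrC ler_wpM2r.
Qed.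

Lemma indic_norm_le1 A w : `|\1_A w : R| <= 1.
Proof. by rewrite indicE; case: (_ \in _); rewrite ?normr1 ?normr0. Qed.

Lemma L1_indic u A : measurable A -> L1 u -> L1 (fun w => u w * \1_A w).
Proof. by move=> mA iu; apply: (L1_mul (M := 1)) => // w; exact: indic_norm_le1. Qed.

Lemma L1_ae u f : measurable_fun setT f -> L1 u ->
  {ae P, forall w, u w = f w} -> L1 f.
Proof.
move=> mf /integrableP[mu fu] uf; apply/integrableP; split.
  exact/measurable_EFinP.
rewrite (le_lt_trans _ fu)// le_eqVlt; apply/orP; left; apply/eqP.
apply: ge0_ae_eq_integral => //.
- exact/measurableT_comp/measurable_EFinP.
- exact/measurableT_comp/mu.
- by apply: filterS uf => w /= ->.
Qed.

Lemma ED u f : L1 u -> L1 f -> E (fun w => u w + f w) = E u + E f.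
Proof. by move=> *; rewrite -RintegralD. Qed.

Lemma EB u f : L1 u -> L1 f -> E (fun w => u w - f w) = E u - E f.
Proof. by move=> *; rewrite -RintegralB. Qed.

Lemma EZ (a : R) u : L1 u -> E (fun w => a * u w) = a * E u.
Proof. by move=> *; rewrite -RintegralZl. Qed.

Lemma E_le u f : L1 u -> L1 f -> (forall w, u w <= f w) -> E u <= E f.
Proof. by move=> *; apply: le_Rintegral. Qed.

Lemma E_ext u f : u =1 f -> E u = E f.
Proof. by move=> uf; apply: eq_Rintegral => w _; exact: uf. Qed.

Lemma E_ae u f : measurable_fun setT u -> measurable_fun setT f ->
  {ae P, forall w, u w = f w} -> E u = E f.
Proof.
move=> mu mf uf; rewrite /Rintegral; congr fine; apply: ae_eq_integral => //.
- exact/measurable_EFinP.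
- exact/measurable_EFinP.
- by apply: filterS uf => w /= ->.
Qed.

Lemma E_sum (I : Type) (s : seq I) (p : pred I) (u : I -> Omega -> R) :
  (forall i, L1 (u i)) ->
  E (fun w => \sum_(i <- s | p i) u i w) = \sum_(i <- s | p i) E (u i).
Proof.
move=> iu; elim: s => [|a s IH].
  rewrite big_nil -[RHS](mul0r (fine (P setT))) -Rintegral_cst//.
  by apply: E_ext => w; rewrite big_nil.
rewrite big_cons -IH; case: ifPn => pa; last first.
  by apply: E_ext => w; rewrite big_cons (negbTE pa).
by rewrite -ED//; [apply: E_ext => w; rewrite big_cons pa|exact: L1_sum].
Qed.

Lemma E_cst (a : R) : E (fun=> a) = a.
Proof. by rewrite Rintegral_cst//= [X in fine X](@probability_setT _ _ _ P) mulr1. Qed.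

Lemma E_norm_le u : L1 u -> `|E u| <= E (fun w => `|u w|).
Proof. by move=> iu; apply: le_normr_Rintegral. Qed.

Lemma E_indic A : measurable A -> E (\1_A) = fine (P A).
Proof. by move=> mA; rewrite /Rintegral integral_indic// setIT. Qed.

Lemma integral_L1 u : L1 u -> (\int[P]_w (u w)%:E = (E u)%:E)%E.
Proof. by move=> iu; rewrite fineK//; exact: integrable_fin_num. Qed.

Lemma integral_in_L1 u A : measurable A -> L1 u ->
  (\int[P]_(w in A) (u w)%:E = (E (fun w => u w * \1_A w))%:E)%E.
Proof.
move=> mA iu; rewrite integral_mkcond -integral_L1; last exact: L1_indic.
apply: eq_integral => w _; rewrite patchE indicE.
by case: (_ \in _); rewrite ?mulr1 ?mulr0.
Qed.

(** The complements decrease to the empty set, so continuity from above applies. Truncation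
    arguments get their small exceptional sets from here. *)
Lemma prob_lt_compl_bigcup (B : nat -> set Omega) :
  (forall k, measurable (B k)) -> nondecreasing_seq B -> (forall w, exists k, B k w) ->
  forall e : R, 0 < e -> exists k, (P (~` B k) < e%:E)%E.
Proof.
move=> mB ndB cB e e0.
have mCB k : measurable (~` B k) by exact: measurableC.
have c0 : P \o (fun k => ~` B k) @ \oo --> P (\bigcap_k ~` B k).
  apply: nonincreasing_cvg_mu => //.
  - by rewrite (le_lt_trans (probability_le1 _ _))// ltry.
  - exact: bigcapT_measurable.
  - by move=> m n mn; rewrite subsetEset; apply: subsetC; rewrite -subsetEset; exact: ndB.
have b0 : \bigcap_k ~` B k = set0.
  apply/seteqP; split => // w bw; have [k Bk] := cB w; exact: (bw k I Bk).
rewrite b0 measure0 in c0.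
have /fine_cvgP[] := c0.
move=> ff /cvgrPdist_lt /(_ e e0) H.
have [k _ /(_ k (leqnn k)) [] /=] : \forall k \near \oo, P (~` B k) \is a fin_num /\ `|0 - fine (P (~` B k))| < e.
  near=> k; split; near: k => //.
rewrite sub0r normrN => fk; rewrite ger0_norm ?fine_ge0// => ke.
by exists k; rewrite -(fineK fk) lte_fin.
Unshelve. all: by end_near.
Qed.

Lemma norm_sublevel_cover u : measurable_fun setT u ->
  [/\ forall k : nat, measurable [set w | `|u w| <= k%:R],
      nondecreasing_seq (fun k : nat => [set w | `|u w| <= k%:R]) &
      forall w, exists k : nat, `|u w| <= k%:R].
Proof.
move=> mu; split.
- move=> k; have -> : [set w | `|u w| <= k%:R] = (Num.norm \o u) @^-1` `]-oo, k%:R].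
    by apply/seteqP; split => w /=; rewrite in_itv.
  by rewrite -[X in measurable X]setTI; apply: (measurableT_comp _ mu) => //.
- move=> m n mn; rewrite subsetEset => w /= /le_trans; apply.
  by rewrite ler_nat.
- by move=> w; exists (Num.truncn `|u w|).+1; exact/ltW/truncnS_gt.
Qed.

(** Monotone convergence along the exhaustion: a bound uniform in [k] yields integrability on the
    whole space. *)
Lemma L1_bounded_exhaustion u (B : nat -> set Omega) (K : R) :
  measurable_fun setT u ->
  (forall w, 0 <= u w) ->
  (forall k, measurable (B k)) -> nondecreasing_seq B -> (forall w, exists k, B k w) ->
  (forall k, L1 (fun w => u w * \1_(B k) w)) ->
  (forall k, E (fun w => u w * \1_(B k) w) <= K) -> L1 u.
Proof.
move=> mu u0 mB ndB cB iB EB; apply/integrableP; split.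
  exact/measurable_EFinP.
rewrite (eq_integral (EFin \o u)); last first.
  by move=> w _ /=; rewrite ger0_norm.
have bT : \bigcup_k B k = setT.
  by apply/seteqP; split => // w _; have [k Bk] := cB w; exists k.
have := @ge0_nondecreasing_set_cvg_integral _ _ _ B (EFin \o u) P ndB mB.
move=> /(_ _ _)/wrap[].
  by move=> k; apply/measurable_funTS/measurable_EFinP.
  by move=> k w _; rewrite lee_fin.
rewrite bT => c.
apply: (@le_lt_trans _ _ K%:E); last exact: ltry.
apply: (cvge_le _ c); apply: nearW => k.
rewrite (_ : integral _ _ _ = (E (fun w => u w * \1_(B k) w))%:E) ?lee_fin//.
rewrite integral_mkcond -integral_L1//; apply: eq_integral => w _.
by rewrite patchE indicE; case: (_ \in _); rewrite /= ?mulr1 ?mulr0.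
Qed.

(** Split at the level [|u| <= k]: the part above it has integral at most [e / 2], and below it a
    set [A] contributes at most [k * P A]. *)
Lemma E_absolutely_continuous u : L1 u -> forall e : R, 0 < e ->
  exists2 r : R, 0 < r & forall A, measurable A -> (P A < r%:E)%E ->
    E (fun w => `|u w| * \1_A w) <= e.
Proof.
move=> iu e e0.
have mu := L1_measurable iu.
have [mB ndB cB] := norm_sublevel_cover mu.
pose B k := [set w | `|u w| <= k%:R].
have ieB k : L1 (fun w => `|u w| * \1_(B k) w) by apply: L1_indic; [exact: mB|exact: L1_norm].
have c : E (fun w => `|u w| * \1_(B k) w) @[k --> \oo] --> E (fun w => `|u w|).
  have := @ge0_nondecreasing_set_cvg_integral _ _ _ B (EFin \o (fun w => `|u w|)) P ndB mB.
  move=> /(_ _ _)/wrap[].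
    by move=> k; apply/measurable_funTS/measurable_EFinP; exact: measurableT_comp.
    by move=> k w _; rewrite lee_fin.
  have -> : \bigcup_k B k = setT.
    by apply/seteqP; split => // w _; have [k Bk] := cB w; exists k.
  rewrite [X in _ --> X](_ : _ = (E (fun w => `|u w|))%:E); last first.
    by rewrite -integral_L1//; exact: L1_norm.
  have -> : (fun k => \int[P]_(x in B k) (EFin \o (fun w => `|u w|%R)) x)%E =
     EFin \o (fun k => E (fun w => `|u w| * \1_(B k) w)).
    by apply/funext => k; rewrite (integral_in_L1 (mB k))//; exact: L1_norm.
  by move=> /fine_cvg.
move/cvgrPdist_lt : c => /(_ (e / 2)) /(_ _)/wrap[]; first by rewrite divr_gt0.
move=> [k _ /(_ k (leqnn k)) /= Hk].
(* The [+ 1] covers the level [k = 0]. *)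
exists (e / 2 / (k%:R + 1)); first by rewrite !divr_gt0// ltr_wpDl.
move=> A mA PA.
have iA : L1 (\1_A) by apply: (L1_bounded (M := 1)) => // w; exact: indic_norm_le1.
have i1 : L1 (fun w => `|u w| - `|u w| * \1_(B k) w).
  by apply: L1B => //; exact: L1_norm.
have i2 : L1 (fun w => k%:R * \1_A w) by exact: L1Z.
have le1 : E (fun w => `|u w| * \1_A w) <=
  E (fun w => (`|u w| - `|u w| * \1_(B k) w) + k%:R * \1_A w).
  apply: E_le.
  - by apply: L1_indic => //; exact: L1_norm.
  - exact: L1D.
  - move=> w; rewrite !indicE.
    have [wB|wB] := boolP (w \in B k); have [wA|wA] := boolP (w \in A);
      rewrite ?mulr1 ?mulr0 ?subr0 ?addr0 ?subrr ?add0r ?lerDl//.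
    by move: wB; rewrite inE.
rewrite (le_trans le1)// ED// EB//; last exact: L1_norm.
rewrite EZ// E_indic//.
have Pf : P A \is a fin_num by rewrite ge0_fin_numE// (le_lt_trans (probability_le1 _ mA))// ltry.
move: PA; rewrite -(fineK Pf) lte_fin => PA.
have h1 : k%:R * fine (P A) <= e / 2.
  have := ltW PA; rewrite ler_pdivlMr ?ltr_wpDl// => le2.
  rewrite (le_trans _ le2)// mulrC ler_wpM2l ?fine_ge0// lerDl//.
have := ler_norm (E (fun w => `|u w|) - E (fun w => `|u w| * \1_(B k) w)).
move: Hk h1; lra.
Qed.

End integrable_functions.

(** * Functions measurable for a sub-sigma-algebra, and densities of set functions on it *)

Definition measurable_wrt {Omega : Type} {d' : measure_display} {T' : measurableType d'}
    (G : set (set Omega)) (f : Omega -> T') :=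
  forall B : set T', measurable B -> G (f @^-1` B).

Section sub_sigma_algebra.
Context {d : measure_display} {Omega : measurableType d} {R : realType}.
Variables (P : probability Omega R) (G : set (set Omega)).
Hypotheses (sG : sigma_algebra setT G) (GM : G `<=` measurable).
Implicit Types (u f g : Omega -> R) (A B : set Omega).
Local Notation L1 u := (P.-integrable setT (EFin \o u)).
Local Notation E u := (Rintegral P setT u).
Local Notation OmegaG := (g_sigma_algebraType G).

Let measurableG : @measurable _ OmegaG = G.
Proof. exact: measurable_g_measurableTypeE. Qed.

(** Passes between the plain family of sets [G] and the measurable space [OmegaG] it generates, so
    that closure properties follow from those of measurable functions. *)
Lemma measurable_wrtP d' (T' : measurableType d') (f : Omega -> T') :
  measurable_wrt G f <-> measurable_fun setT (f : OmegaG -> T').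
Proof.
split=> [mf _ B mB|mf B mB].
  by rewrite setTI measurableG; exact: mf.
by have := mf measurableT B mB; rewrite setTI measurableG.
Qed.

Lemma measurable_wrt_measurable f : measurable_wrt G f -> measurable_fun setT f.
Proof. by move=> mf _ B mB; rewrite setTI; apply: GM; exact: mf. Qed.

Lemma measurable_wrt_comp (g : R -> R) f : measurable_fun setT g ->
  measurable_wrt G f -> measurable_wrt G (g \o f).
Proof.
by move=> mg /measurable_wrtP mf; apply/measurable_wrtP; exact: measurableT_comp.
Qed.

Lemma measurable_wrtD f g : measurable_wrt G f -> measurable_wrt G g ->
  measurable_wrt G (fun w => f w + g w).
Proof.
by move=> /measurable_wrtP mf /measurable_wrtP mg; apply/measurable_wrtP;
   exact: measurable_funD.
Qed.

Lemma measurable_wrtB f g : measurable_wrt G f -> measurable_wrt G g ->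
  measurable_wrt G (fun w => f w - g w).
Proof.
by move=> /measurable_wrtP mf /measurable_wrtP mg; apply/measurable_wrtP;
   exact: measurable_funB.
Qed.

Lemma measurable_wrtM f g : measurable_wrt G f -> measurable_wrt G g ->
  measurable_wrt G (fun w => f w * g w).
Proof.
by move=> /measurable_wrtP mf /measurable_wrtP mg; apply/measurable_wrtP;
   exact: measurable_funM.
Qed.

Lemma measurable_wrt_cst (a : R) : measurable_wrt G (fun=> a).
Proof. by apply/measurable_wrtP; exact: measurable_cst. Qed.

Lemma measurable_wrt_sum (I : Type) (s : seq I) (q : pred I) (x : I -> Omega -> R) :
  (forall i, q i -> measurable_wrt G (x i)) ->
  measurable_wrt G (fun w => \sum_(i <- s | q i) x i w).
Proof.
move=> mx; elim: s => [|i s IH].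
  rewrite (_ : (fun w => _) = fun=> 0); first exact: measurable_wrt_cst.
  by apply/funext => w; rewrite big_nil.
have [qi|qi] := boolP (q i).
  rewrite (_ : (fun w => _) = fun w => x i w + \sum_(i <- s | q i) x i w).
    by apply: measurable_wrtD => //; exact: mx.
  by apply/funext => w; rewrite big_cons qi.
rewrite (_ : (fun w => _) = fun w => \sum_(i <- s | q i) x i w)//.
by apply/funext => w; rewrite big_cons (negbTE qi).
Qed.

Lemma measurable_wrt_indic A : G A -> measurable_wrt G (\1_A : Omega -> R).
Proof.
move=> GA; apply/measurable_wrtP.
by apply: (@measurable_indic _ OmegaG R setT A); rewrite measurableG.
Qed.

Lemma measurable_wrt_lt f g : measurable_wrt G f -> measurable_wrt G g ->
  G [set w | f w < g w].
Proof.
move=> mf mg; have := measurable_wrtB mg mf.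
move=> /(_ [set` `]0, +oo[] (measurable_itv _)); congr (G _).
by apply/seteqP; split => w /=; rewrite in_itv/= andbT subr_gt0.
Qed.

Lemma sub_sigma_algebraT : G setT.
Proof. by rewrite -measurableG; exact: measurableT. Qed.

Lemma sub_sigma_algebraC A : G A -> G (~` A).
Proof. by rewrite -measurableG; exact: measurableC. Qed.

Section radon_nikodym.
Variable nu : set Omega -> R.
Hypothesis nuD : forall A B, G A -> G B -> A `&` B = set0 ->
  nu (A `|` B) = nu A + nu B.
Hypothesis nu_ac : forall e : R, 0 < e -> exists2 r : R, 0 < r &
  forall A, G A -> (P A < r%:E)%E -> `|nu A| <= e.

Let nuG (A : set OmegaG) : \bar R := (nu A)%:E.

Let nu0 : nu set0 = 0.
Proof.
have G0 : G set0 by rewrite -measurableG; exact: measurable0.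
have := nuD G0 G0 (set0I _); rewrite setU0 => /eqP.
by rewrite addrC -subr_eq subrr => /eqP.
Qed.

(** The remainder of the series is the value of [nu] on the tail union [T n]. The tails decrease to
    the empty set, so their probability tends to 0 and [nu_ac] makes the remainder small. *)
Let nuG_sigma_additive : semi_sigma_additive nuG.
Proof.
move=> F mF tF mUF; pose T n := \bigcup_(i in [set i | (n <= i)%N]) F i.
have GF i : G (F i) by rewrite -measurableG.
have GT n : G (T n).
  by rewrite -measurableG; apply: bigcup_measurable => i _; rewrite measurableG.
have TS n : T n = F n `|` T n.+1.
  apply/seteqP; split => [w [i /= ni Fi]|w [Fw|[i /= ni Fi]]].
  - move: ni; rewrite leq_eqVlt => /predU1P[->|ni]; first by left.
    by right; exists i.
  - by exists n => //=.
  - by exists i => //=; exact: ltnW.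
have FT n : F n `&` T n.+1 = set0.
  apply/seteqP; split => // w [Fw [i /= ni Fi]].
  have /trivIsetP/(_ n i I I) := tF.
  by rewrite (ltn_eqF ni) => /(_ isT) /seteqP[/(_ w) + _]; apply.
have T0 : T 0%N = \bigcup_n F n.
  by apply/seteqP; split => w [i _ Fi]; exists i.
have nuT n : nu (\bigcup_n F n) = \sum_(0 <= i < n) nu (F i) + nu (T n).
  elim: n => [|n IH]; first by rewrite big_nil add0r T0.
  by rewrite big_nat_recr//= -addrA -nuD// -TS.
suff c : \sum_(0 <= i < n) nu (F i) @[n --> \oo] --> nu (\bigcup_n F n).
  have -> : (fun n => \sum_(0 <= i < n) nuG (F i))%E =
     EFin \o (fun n => \sum_(0 <= i < n) nu (F i)).
    by apply/funext => n; rewrite /= sumEFin.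
  exact: cvg_EFin (nearW _ _) c.
apply/cvgrPdist_le => e e0; have [r r0 rP] := nu_ac e0.
have [||w|k Pk] := @prob_lt_compl_bigcup _ _ _ P (fun k => ~` T k) _ _ _ r r0.
- by move=> k; apply: measurableC; apply: GM.
- move=> m n mn; rewrite subsetEset; apply: subsetC => w [i /= ni Fi].
  by exists i => //=; exact: leq_trans ni.
- have [[i Fi]|nF] := pselect (exists i, F i w).
    exists i.+1 => -[j /= ij Fj].
    have /trivIsetP/(_ i j I I) := tF.
    by rewrite (ltn_eqF ij) => /(_ isT) /seteqP[/(_ w) + _]; apply.
  by exists 0%N => -[i _ Fi]; apply: nF; exists i.
rewrite setCK in Pk.
exists k => // n /= kn; rewrite (nuT n) addrC addKr; apply: rP => //.
apply: le_lt_trans Pk; apply: le_measure; rewrite ?inE; [exact: GM|exact: GM|].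
by move=> w [i /= ni Fi]; exists i => //=; exact: leq_trans ni.
Qed.

HB.instance Definition _ := isCharge.Build _ OmegaG R nuG
  (congr1 EFin nu0) (fun _ _ => isT) nuG_sigma_additive.

(** The identity seen as a map into the coarser space; its distribution is [P] restricted to [G]. *)
Let idG : Omega -> OmegaG := id.

Let idG_measurable : measurable_fun setT idG.
Proof. by move=> _ A; rewrite measurableG setTI; exact: GM. Qed.

HB.instance Definition _ := isMeasurableFun.Build _ _ _ _ idG idG_measurable.

(** Radon-Nikodym on the coarser space, with the derivative pulled back to [Omega]. It serves twice:
    on a sub-sigma-algebra to construct conditional expectations, and on the full one to find the
    density in the Yosida-Hewitt decomposition. *)
Lemma radon_nikodym_sub : exists f,
  [/\ measurable_wrt G f, L1 f & forall A, G A -> E (fun w => f w * \1_A w) = nu A].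
Proof.
pose PG := distribution P idG.
have dom : nuG `<< PG.
  apply/null_content_dominatesP => A; rewrite measurableG => GA PA.
  apply/eqP; rewrite eqe -normr_le0; apply/ler_addgt0Pl => e e0; rewrite addr0.
  have [r r0 rP] := nu_ac e0; apply: rP => //.
  by rewrite (_ : P A = 0%E) ?lte_fin.
pose D := Radon_Nikodym nuG PG.
have iD : PG.-integrable setT D by exact: Radon_Nikodym_integrable.
have fD w : D w = (fine (D w))%:E by rewrite fineK//; exact: Radon_Nikodym_fin_num.
pose f w := fine (D w).
have mf : measurable_wrt G f.
  apply/measurable_wrtP; apply/measurable_EFinP.
  by rewrite (_ : EFin \o f = D); [exact: measurable_int iD|apply/funext => w; rewrite /= -fD].
have if_ : L1 f.
  apply/integrableP; split; first exact/measurable_EFinP/measurable_wrt_measurable.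
  have := ge0_integral_distribution idG (f := fun w => `|D w|%E).
  move=> /(_ P _ _)/wrap[].
    by apply: measurableT_comp => //; exact: measurable_int iD.
    by move=> w; exact: abse_ge0.
  move=> H; have /integrableP[_] := iD; rewrite H.
  by under eq_integral do rewrite /= fD.
exists f; split => // A GA.
apply/eqP; rewrite -eqe -integral_in_L1//; last exact: GM.
have mA : (@measurable _ OmegaG) A by rewrite measurableG.
have -> : (nu A)%:E = (\int[PG]_(x in A) D x)%E by rewrite -Radon_Nikodym_integral.
rewrite /PG /distribution integral_pushforward//=.
- by apply/eqP/eq_integral => w _; rewrite -fD.
- exact: measurable_int iD.
- rewrite (_ : D \o idG = EFin \o f); last by apply/funext => w; rewrite /= fD.
  by apply: integrableS if_ => //; exact: GM.
Qed.

End radon_nikodym.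

(** A functional monotone class argument with uniform instead of monotone limits: norm continuity is
    all that a finitely additive functional offers. *)
Lemma bounded_measurable_ind (Q : (Omega -> R) -> Prop) :
  (forall A, G A -> Q \1_A) ->
  (forall (a : R) f g, Q f -> Q g -> Q (fun w => a * f w + g w)) ->
  (forall f, measurable_wrt G f -> (exists M : R, forall w, `|f w| <= M) ->
     (forall e : R, 0 < e -> exists2 g, Q g & forall w, `|f w - g w| <= e) -> Q f) ->
  forall f, measurable_wrt G f -> (exists M : R, forall w, `|f w| <= M) -> Q f.
Proof.
move=> Q1 Ql Qc.
have Q0 : Q (fun=> 0).
  have := Ql (-1) _ _ (Q1 _ sub_sigma_algebraT) (Q1 _ sub_sigma_algebraT).
  by congr Q; apply/funext => w; rewrite mulN1r addNr.
(* Subtracting [M / 2] times the sign halves the bound of [f]. *)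
have H k (M : R) f : measurable_wrt G f -> (forall w, `|f w| <= M) ->
    exists2 g, Q g & forall w, `|f w - g w| <= M / 2 ^+ k.
  elim: k M f => [|k IH] M f mf fM.
    by exists (fun=> 0) => // w; rewrite subr0 expr0 divr1.
  have GA : G [set w | 0 <= f w].
    have := mf [set` `[0, +oo[] (measurable_itv _); congr (G _).
    by apply/seteqP; split => w /=; rewrite in_itv/= andbT.
  set A := [set w | 0 <= f w] in GA.
  have GCA := sub_sigma_algebraC GA.
  (* The trailing [0] gives [s] the shape [a * f + g] on which [Ql] acts. *)
  pose s w := M / 2 * \1_A w + (- (M / 2) * \1_(~` A) w + 0).
  have Qs : Q s by apply: (Ql _); [exact: Q1|apply: (Ql _) => //; exact: Q1].
  have ms : measurable_wrt G s.
    apply: measurable_wrtD; first apply: measurable_wrtM; first exact: measurable_wrt_cst.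
      exact: measurable_wrt_indic.
    apply: measurable_wrtD; last exact: measurable_wrt_cst.
    apply: measurable_wrtM; first exact: measurable_wrt_cst.
    exact: measurable_wrt_indic.
  have [|w|g Qg gP] := IH (M / 2) (fun w => f w - s w).
  - exact: measurable_wrtB.
  - rewrite /s !indicE in_setC; have := fM w.
    have [wA|wA] := boolP (w \in A); rewrite ?mulr1 ?mulr0 ?addr0 ?add0r.
      by move: wA; rewrite inE /A/= !ler_norml => f0 /andP[_ fm]; apply/andP; split; lra.
    have f0 : f w < 0 by rewrite ltNge; apply: contra wA => ?; rewrite inE.
    by rewrite !ler_norml => /andP[fm _]; apply/andP; split; lra.
  exists (fun w => 1 * s w + g w); first exact: Ql.
  by move=> w; rewrite mul1r opprD addrA (le_trans (gP w))// exprS invfM mulrA.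
move=> f mf [M fM]; apply: (Qc f mf); first by exists M.
move=> e e0.
have [k kP] : exists k, `|M| / 2 ^+ k <= e.
  exists (Num.truncn (`|M| / e)).+1; rewrite ler_pdivrMr ?exprn_gt0// mulrC -ler_pdivrMr//.
  rewrite (le_trans (ltW (truncnS_gt _)))// -natrX ler_nat.
  exact/ltnW/ltn_expl.
have [|g Qg gP] := H k `|M| f mf; first by move=> w; rewrite (le_trans (fM w))// ler_norm.
by exists g => // w; exact: le_trans (gP w) kP.
Qed.

End sub_sigma_algebra.

(** * Conditional expectation of bounded functions *)

Definition bounded_measurable {d : measure_display} {Omega : measurableType d}
    {R : realType} (f : Omega -> R) :=
  measurable_fun setT f /\ exists M : R, forall w, `|f w| <= M.

Section conditional_expectation.
Context {d : measure_display} {Omega : measurableType d} {R : realType}.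
Variables (P : probability Omega R) (G : set (set Omega)).
Hypotheses (sG : sigma_algebra setT G) (GM : G `<=` measurable).
Implicit Types (u f g : Omega -> R) (A B : set Omega).
Local Notation L1 u := (P.-integrable setT (EFin \o u)).
Local Notation E u := (Rintegral P setT u).

Lemma bounded_measurable_L1 f : bounded_measurable f -> L1 f.
Proof. by move=> [mf [M fM]]; exact: L1_bounded fM. Qed.

Lemma L1_mul_bounded u f : L1 u -> bounded_measurable f -> L1 (fun w => u w * f w).
Proof. by move=> iu [mf [M fM]]; exact: L1_mul fM. Qed.

Lemma bounded_measurable_indic A : measurable A ->
  bounded_measurable (\1_A : Omega -> R).
Proof. by move=> mA; split => //; exists 1 => w; exact: indic_norm_le1. Qed.

Lemma bounded_measurable_cst (a : R) : bounded_measurable (fun _ : Omega => a).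
Proof. by split => //; exists `|a|. Qed.

Lemma bounded_measurable_lin (a : R) f g : bounded_measurable f ->
  bounded_measurable g -> bounded_measurable (fun w => a * f w + g w).
Proof.
move=> [mf [M fM]] [mg [K gK]]; split.
  by apply: measurable_funD => //; exact: measurable_funM.
exists (`|a| * M + K) => w; rewrite (le_trans (ler_normD _ _))// lerD// normrM.
by rewrite ler_wpM2l.
Qed.

Lemma bounded_measurableM f g : bounded_measurable f ->
  bounded_measurable g -> bounded_measurable (fun w => f w * g w).
Proof.
move=> [mf [M fM]] [mg [K gK]]; split; first exact: measurable_funM.
by exists (M * K) => w; rewrite normrM ler_pM.
Qed.

(** Classes in L^infty are handled through representatives bounded everywhere, so that products,
    clippings and gluings involve no null sets. *)
Lemma ae_bounded_version u (M : R) : measurable_fun setT u ->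
  {ae P, forall w, `|u w| <= M} ->
  exists v : Omega -> R, [/\ measurable_fun setT v, forall w, `|v w| <= M &
                {ae P, forall w, u w = v w}].
Proof.
(* A negative [M] would be contradictory at almost every point, against [P setT = 1]. *)
move=> mu uM; have M0 : 0 <= M.
  apply/negP => /negP; rewrite -ltNge => M0.
  have : {ae P, forall w, False}.
    by apply: filterS uM => w /(le_trans (normr_ge0 _)); rewrite leNgt M0.
  move=> [N [mN PN]]; rewrite (_ : ~` _ = setT); last by apply/seteqP; split => // w _ [].
  rewrite subTset => NT; move: PN; rewrite NT.
  by rewrite (@probability_setT _ _ _ P) => /eqP; rewrite onee_eq0.
exists (fun w => Num.max (- M) (Num.min M (u w))); split.
- by apply: measurable_maxr => //; exact: measurable_minr.
- move=> w; rewrite ler_norml le_max lexx/= ge_max ge_min lexx/= andbT.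
  by rewrite -subr_ge0 opprK addr_ge0.
- by apply: filterS uM => w; rewrite ler_norml => /andP[a b]; rewrite min_r// max_r.
Qed.

Lemma E_norm_le_bounded u f (e : R) : L1 u -> measurable_fun setT f ->
  (forall w, `|f w| <= e) -> `|E (fun w => u w * f w)| <= e * E (fun w => `|u w|).
Proof.
move=> iu mf fe; have i1 := L1_mul iu mf fe.
rewrite (le_trans (E_norm_le i1))// -EZ; last exact: L1_norm.
apply: E_le; [exact: L1_norm|by apply: L1Z; exact: L1_norm|].
by move=> w; rewrite normrM mulrC ler_wpM2r.
Qed.

Lemma E_mul_eq_on_bounded u f : L1 u -> L1 f ->
  (forall A, G A -> E (fun w => u w * \1_A w) = E (fun w => f w * \1_A w)) ->
  forall y : Omega -> R, measurable_wrt G y -> (exists M : R, forall w, `|y w| <= M) ->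
    E (fun w => u w * y w) = E (fun w => f w * y w).
Proof.
move=> iu jf uf y my yM.
pose Q (y : Omega -> R) := bounded_measurable y /\ E (fun w => u w * y w) = E (fun w => f w * y w).
suff [] : Q y by [].
apply: (bounded_measurable_ind sG _ _ _ my yM) => {y my yM}.
- by move=> A GA; split; [apply: bounded_measurable_indic; exact: GM|exact: uf].
- move=> a y z [by_ Ey] [bz Ez]; split; first exact: bounded_measurable_lin.
  have H v : L1 v -> E (fun w => v w * (a * y w + z w)) =
      a * E (fun w => v w * y w) + E (fun w => v w * z w).
    move=> iv; have [jy jz] := (L1_mul_bounded iv by_, L1_mul_bounded iv bz).
    rewrite -EZ// -ED//; last exact: L1Z.
    by apply: E_ext => w; rewrite mulrDr mulrCA.
  by rewrite !H// Ey Ez.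
- move=> y my yM yQ; have by_ : bounded_measurable y.
    by split => //; exact: (measurable_wrt_measurable GM).
  split => //; apply/eqP; rewrite -subr_eq0 -normr_le0; apply/ler_addgt0Pl => e e0.
  (* The [+ 1] keeps [K] positive when both L^1 norms vanish. *)
  rewrite addr0; pose K := E (fun w => `|u w|) + E (fun w => `|f w|) + 1.
  have K0 : 0 < K.
    by rewrite ltr_wpDl// addr_ge0//; apply: Rintegral_ge0.
  have [|z [bz Ez] zP] := yQ (e / K); first by rewrite divr_gt0.
  have H v : L1 v -> E (fun w => v w * y w) =
      E (fun w => v w * (y w - z w)) + E (fun w => v w * z w).
    move=> iv; rewrite -ED; last exact: L1_mul_bounded.
      by apply: E_ext => w; rewrite -mulrDr subrK.
    apply: (L1_mul iv _ zP); exact: measurable_funB by_.1 bz.1.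
  rewrite (H _ iu) (H _ jf) Ez opprD addrACA subrr addr0.
  have myz : measurable_fun setT (fun w => y w - z w) by exact: measurable_funB by_.1 bz.1.
  rewrite (le_trans (ler_normB _ _))//.
  rewrite (le_trans (lerD (E_norm_le_bounded iu myz zP) (E_norm_le_bounded jf myz zP)))//.
  rewrite -mulrDr mulrAC ler_pdivrMr// ler_wpM2l ?ltW//.
  by rewrite /K ltrDl.
Qed.

(** Test on the set where [g < f]: there [f - g] is positive but has nonpositive integral. *)
Lemma ae_le_of_E_le f g : measurable_wrt G f -> measurable_wrt G g ->
  L1 f -> L1 g ->
  (forall A, G A -> E (fun w => f w * \1_A w) <= E (fun w => g w * \1_A w)) ->
  {ae P, forall w, f w <= g w}.
Proof.
move=> mf mg jf ig fg; set A := [set w | g w < f w].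
have GA : G A by exact: measurable_wrt_lt.
have mA : measurable A by exact: GM.
pose u w := (f w - g w) * \1_A w.
have iu : L1 u by apply: L1_indic => //; exact: L1B.
have u0 w : 0 <= u w.
  rewrite /u indicE; have [wA|wA] := boolP (w \in A); rewrite ?mulr1 ?mulr0//.
  by move: wA; rewrite inE /A/= subr_ge0 => /ltW.
have Eu : E u <= 0.
  rewrite (_ : E u = E (fun w => f w * \1_A w) - E (fun w => g w * \1_A w)).
    by rewrite subr_le0; exact: fg.
  by rewrite -EB; [apply: E_ext => w; rewrite /u mulrBl|exact: L1_indic..].
have /(ae_eq_integral_abs P measurableT) : measurable_fun setT (EFin \o u).
  exact: measurable_int iu.
case=> + _; have -> : (\int[P]_x `|(EFin \o u) x| = 0)%E.
  apply/eqP; rewrite eq_le integral_ge0// andbT.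
  rewrite (eq_integral (EFin \o u)); last by move=> w _ /=; rewrite ger0_norm.
  by rewrite integral_L1// lee_fin.
move=> /(_ erefl); apply: filterS => w /= /(_ I) -[uw]; rewrite leNgt; apply/negP => gf.
by move: uw; rewrite /u indicE mem_set// mulr1 => /eqP; rewrite subr_eq0 gt_eqF.
Qed.

Lemma ae_eq_of_E_eq f g : measurable_wrt G f -> measurable_wrt G g ->
  L1 f -> L1 g ->
  (forall A, G A -> E (fun w => f w * \1_A w) = E (fun w => g w * \1_A w)) ->
  {ae P, forall w, f w = g w}.
Proof.
move=> mf mg jf ig fg.
have h1 : {ae P, forall w, f w <= g w} by apply: ae_le_of_E_le => // A GA; rewrite fg.
have h2 : {ae P, forall w, g w <= f w} by apply: ae_le_of_E_le => // A GA; rewrite fg.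
by apply: filterS2 h1 h2 => w a b; apply/eqP; rewrite eq_le a.
Qed.

(** The conditional expectation is the density of the indefinite integral of [u] on [G], whose
    absolute continuity is [E_absolutely_continuous]. *)
Lemma cond_exp_L1 u : L1 u -> exists f, [/\ measurable_wrt G f, L1 f &
  forall A, G A -> E (fun w => f w * \1_A w) = E (fun w => u w * \1_A w)].
Proof.
move=> iu; apply: (radon_nikodym_sub sG GM) => [A B GA GB AB|e e0].
  rewrite -ED; [|by apply: L1_indic => //; exact: GM..].
  apply: E_ext => w; rewrite -mulrDr; congr (_ * _).
  rewrite !indicE in_setU; have [wA|wA] := boolP (w \in A); have [wB|wB] := boolP (w \in B);
    rewrite ?addr0 ?add0r//.
  by move: wA wB; rewrite !inE => wA wB; have : (A `&` B) w by []; rewrite AB.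
have [r r0 rP] := E_absolutely_continuous iu e0.
exists r => // A GA PA; rewrite (le_trans _ (rP A (GM GA) PA))//.
rewrite (le_trans (E_norm_le (L1_indic (GM GA) iu)))// le_eqVlt; apply/orP; left.
by apply/eqP/E_ext => w; rewrite normrM [X in _ * X]ger0_norm// indicE; case: (_ \in _).
Qed.

Definition is_cond_exp u f := [/\ measurable_wrt G f,
  exists M : R, forall w, `|f w| <= M &
  forall A, G A -> E (fun w => f w * \1_A w) = E (fun w => u w * \1_A w)].

(** Comparison with the constants [M] and [- M] bounds the density almost surely; clipping makes the
    bound hold everywhere and preserves [G]-measurability. *)
Lemma cond_exp_bounded u : bounded_measurable u -> exists f, is_cond_exp u f.
Proof.
move=> [mu [M uM]]; have iu : L1 u by exact: L1_bounded uM.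
have [f [mf jf fP]] := cond_exp_L1 iu.
have iM (a : R) : L1 (fun=> a) by apply: bounded_measurable_L1; exact: bounded_measurable_cst.
have mfM : {ae P, forall w, f w <= M}.
  apply: ae_le_of_E_le => //; first exact: measurable_wrt_cst.
  move=> A GA; rewrite fP//; apply: E_le; [by apply: L1_indic => //; exact: GM..|].
  move=> w; rewrite ler_wpM2r//.
  exact: le_trans (ler_norm _) (uM w).
have mMf : {ae P, forall w, - M <= f w}.
  apply: ae_le_of_E_le => //; first exact: measurable_wrt_cst.
  move=> A GA; rewrite fP//; apply: E_le; [by apply: L1_indic => //; exact: GM..|].
  move=> w; rewrite ler_wpM2r//.
  by have := uM w; rewrite ler_norml => /andP[].
pose g w := Num.max (- M) (Num.min M (f w)).
have mg : measurable_wrt G g.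
  apply: (measurable_wrt_comp sG (g := fun x => Num.max (- M) (Num.min M x))) mf.
  by apply: measurable_maxr => //; exact: measurable_minr.
have fg : {ae P, forall w, g w = f w}.
  apply: filterS2 mfM mMf => w fM Mf; rewrite /g min_r//; exact: max_r.
have M0 : 0 <= M by exact: le_trans (uM point).
exists g; split => //.
- exists M => w; rewrite ler_norml /g le_max lexx/= ge_max ge_min lexx/= andbT.
  by rewrite -subr_ge0 opprK addr_ge0.
- move=> A GA; rewrite -fP//; apply: E_ae.
  + apply: measurable_funM; first exact: (measurable_wrt_measurable GM).
    by apply: measurable_indic; exact: GM.
  + exact: (L1_measurable (L1_indic (GM GA) jf)).
  + by apply: filterS fg => w ->.
Qed.

(* The default value is only met when [u] is not bounded and measurable. *)
Definition cond_exp u : Omega -> R := xget (fun=> 0) [set f | is_cond_exp u f].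

Lemma cond_expP u : bounded_measurable u -> is_cond_exp u (cond_exp u).
Proof. by move=> /cond_exp_bounded[f fP]; apply: xgetPex; exists f. Qed.

Lemma cond_exp_bounded_measurable u : bounded_measurable u ->
  bounded_measurable (cond_exp u).
Proof.
by move=> /cond_expP[mf fM _]; split => //; exact: (measurable_wrt_measurable GM).
Qed.

Lemma cond_exp_unique u f : bounded_measurable u -> measurable_wrt G f -> L1 f ->
  (forall A, G A -> E (fun w => f w * \1_A w) = E (fun w => u w * \1_A w)) ->
  {ae P, forall w, cond_exp u w = f w}.
Proof.
move=> bu mf jf fP; have [mc _ cP] := cond_expP bu.
apply: ae_eq_of_E_eq => //.
  by apply: bounded_measurable_L1; exact: cond_exp_bounded_measurable.
by move=> A GA; rewrite cP// fP.
Qed.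

Lemma cond_exp_id u : bounded_measurable u -> measurable_wrt G u ->
  {ae P, forall w, cond_exp u w = u w}.
Proof. by move=> bu mu; apply: cond_exp_unique => //; exact: bounded_measurable_L1. Qed.

Lemma cond_exp_lin (a : R) u v : bounded_measurable u -> bounded_measurable v ->
  {ae P, forall w, cond_exp (fun w => a * u w + v w) w =
                   a * cond_exp u w + cond_exp v w}.
Proof.
move=> bu bv; have [mu _ uP] := cond_expP bu; have [mv _ vP] := cond_expP bv.
have [bcu bcv] := (cond_exp_bounded_measurable bu, cond_exp_bounded_measurable bv).
apply: cond_exp_unique.
- exact: bounded_measurable_lin.
- apply: measurable_wrtD => //; apply: measurable_wrtM => //; exact: measurable_wrt_cst.
- by apply: bounded_measurable_L1; exact: bounded_measurable_lin.
- move=> A GA; have bA := bounded_measurable_indic (GM GA).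
  have H f g : bounded_measurable f -> bounded_measurable g ->
     E (fun w => (a * f w + g w) * \1_A w) =
     a * E (fun w => f w * \1_A w) + E (fun w => g w * \1_A w).
    move=> bf bg; have [jf ig] := (L1_mul_bounded (bounded_measurable_L1 bf) bA,
      L1_mul_bounded (bounded_measurable_L1 bg) bA).
    rewrite -EZ// -ED//; last exact: L1Z.
    by apply: E_ext => w; rewrite mulrDl mulrA.
  by rewrite !H// uP// vP.
Qed.

Lemma cond_exp_norm_le u (M : R) : bounded_measurable u ->
  {ae P, forall w, `|u w| <= M} -> {ae P, forall w, `|cond_exp u w| <= M}.
Proof.
move=> bu uM; have [mc _ cP] := cond_expP bu.
have ic := bounded_measurable_L1 (cond_exp_bounded_measurable bu).
have [v [mv vM uv']] := ae_bounded_version bu.1 uM.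
have bv : bounded_measurable v by split => //; exists M.
have uv A : measurable A -> E (fun w => u w * \1_A w) = E (fun w => v w * \1_A w).
  move=> mA; have bA := bounded_measurable_indic mA.
  apply: E_ae; [exact: (bounded_measurableM bu bA).1|exact: (bounded_measurableM bv bA).1|].
  by apply: filterS uv' => w ->.
have iM (a : R) : L1 (fun=> a) by apply: bounded_measurable_L1; exact: bounded_measurable_cst.
have iv := bounded_measurable_L1 bv.
have h1 : {ae P, forall w, cond_exp u w <= M}.
  apply: ae_le_of_E_le => //; first exact: measurable_wrt_cst.
  move=> A GA; rewrite cP// uv; last exact: GM.
  apply: E_le; [by apply: L1_indic => //; exact: GM..|].
  move=> w; rewrite ler_wpM2r//.
  exact: le_trans (ler_norm _) (vM w).
have h2 : {ae P, forall w, - M <= cond_exp u w}.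
  apply: ae_le_of_E_le => //; first exact: measurable_wrt_cst.
  move=> A GA; rewrite cP// uv; last exact: GM.
  apply: E_le; [by apply: L1_indic => //; exact: GM..|].
  move=> w; rewrite ler_wpM2r//.
  by have := vM w; rewrite ler_norml => /andP[].
by apply: filterS2 h1 h2 => w a b; rewrite ler_norml a b.
Qed.

(** Both sides are compared with [E (f * cond_exp z)]. Moving the operator off the test function is
    what turns a density composed with [cond_exp] into the density [f]. *)
Lemma cond_exp_selfadjoint u f : L1 u -> measurable_wrt G f -> L1 f ->
  (forall A, G A -> E (fun w => f w * \1_A w) = E (fun w => u w * \1_A w)) ->
  forall z, bounded_measurable z ->
    E (fun w => u w * cond_exp z w) = E (fun w => f w * z w).
Proof.
move=> iu mf jf fP z bz; have [mc bc cP] := cond_expP bz.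
transitivity (E (fun w => f w * cond_exp z w)).
  by apply: E_mul_eq_on_bounded => // A GA; rewrite fP.
(* [f] may be unbounded; truncate it to use it as a test function for [z]. *)
have iz := bounded_measurable_L1 bz.
have bcz := cond_exp_bounded_measurable bz.
have icz := bounded_measurable_L1 bcz.
have [mB ndB cB] := norm_sublevel_cover (measurable_wrt_measurable GM mf).
pose B k := [set w | `|f w| <= k%:R].
have GB k : G (B k).
  have := mf (Num.norm @^-1` [set` `]-oo, k%:R]]).
  move=> /(_ _)/wrap[].
    rewrite -[X in measurable X]setTI.
    by apply: (@normr_measurable R setT) => //; exact: measurable_itv.
  by congr (G _); apply/seteqP; split => w /=; rewrite in_itv.
have Ek k : E (fun w => f w * \1_(B k) w * cond_exp z w) = E (fun w => f w * \1_(B k) w * z w).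
  have H v : E (fun w => f w * \1_(B k) w * v w) = E (fun w => v w * (f w * \1_(B k) w)).
    by apply: E_ext => w; rewrite mulrC.
  rewrite !H; apply: E_mul_eq_on_bounded => //.
    by apply: measurable_wrtM => //; exact: measurable_wrt_indic.
  exists k%:R => w; rewrite indicE; have [wB|wB] := boolP (w \in B k).
    by rewrite mulr1; move: wB; rewrite inE.
  by rewrite mulr0 normr0.
apply/eqP; rewrite -subr_eq0 -normr_le0; apply/ler_addgt0Pl => e e0; rewrite addr0.
pose g w := f w * (cond_exp z w - z w).
have bd : bounded_measurable (fun w => cond_exp z w - z w).
  have := bounded_measurable_lin (-1) bz bcz; congr bounded_measurable.
  by apply/funext => w; rewrite mulN1r addrC.
have ig : L1 g by exact: L1_mul_bounded.
have [r r0 rP] := E_absolutely_continuous ig e0.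
have [k Pk] := prob_lt_compl_bigcup P mB ndB cB r0.
have mCB : measurable (~` B k) by apply: measurableC; exact: mB.
rewrite -EB; [|exact: L1_mul_bounded..].
rewrite (_ : E _ = E (fun w => g w * \1_(~` B k) w)); last first.
  have -> : E (fun w => f w * cond_exp z w - f w * z w) =
     E (fun w => g w * \1_(~` B k) w +
        (f w * \1_(B k) w * cond_exp z w - f w * \1_(B k) w * z w)).
    apply: E_ext => w; rewrite /g !indicE in_setC.
    by case: (_ \in _) => /=; ring.
  have iB : L1 (fun w => f w * \1_(B k) w) by apply: L1_indic => //; exact: mB.
  rewrite ED; [|exact: L1_indic|by apply: L1B; exact: L1_mul_bounded].
  by rewrite EB; [|exact: L1_mul_bounded..]; rewrite Ek subrr addr0.
rewrite (le_trans (E_norm_le _))//; first exact: L1_indic.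
rewrite (le_trans _ (rP _ mCB Pk))// le_eqVlt; apply/orP; left.
by apply/eqP/E_ext => w; rewrite normrM [X in _ * X]ger0_norm// indicE; case: (_ \in _).
Qed.

End conditional_expectation.

(** * Sets on which a superadditive set function concentrates its singular mass *)

Section superadditive_concentration.
Context {d : measure_display} {Omega : measurableType d} {R : realType}.
Variables (P : probability Omega R) (mu : set Omega -> R) (C : R).
Hypothesis mu_ge0 : forall A, 0 <= mu A.
Hypothesis mu_le : forall A, mu A <= C.
Hypothesis mu_mono : forall A B, A `<=` B -> mu A <= mu B.
Hypothesis mu_superadditive : forall A B, measurable A -> measurable B ->
  A `&` B = set0 -> mu A + mu B <= mu (A `|` B).

(* The sets [T j] carry the singular part of [mu]: their [mu]-mass realises
   [inf_r sup {mu A | P A < r}], so off [T j] there is nothing left to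
   concentrate on small sets. *)
Lemma concentration_sets : exists T : nat -> set Omega,
  [/\ forall j, measurable (T j), forall i j, (i <= j)%N -> T j `<=` T i,
      forall e : R, 0 < e -> exists J : nat, forall j, (J <= j)%N -> (P (T j) < e%:E)%E
    & forall e : R, 0 < e -> exists2 r : R, 0 < r &
        exists J : nat, forall j, (J <= j)%N -> forall B, measurable B ->
          (P B < r%:E)%E -> mu (B `\` T j) <= e].
Proof.
pose V r := [set mu A | A in [set A | measurable A /\ (P A < r%:E)%E]].
have V0 r : 0 < r -> V r (mu set0).
  by move=> r0; exists set0 => //; split => //; rewrite measure0 lte_fin.
have supV r : 0 < r -> has_sup (V r).
  move=> r0; split; first by exists (mu set0); exact: V0.
  by exists C => _ [A _ <-].
pose W := [set sup (V r) | r in [set r | 0 < r]].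
have infW : has_inf W.
  split; first by exists (sup (V 1)); exists 1 => //=.
  exists 0 => _ [r r0 <-].
  by rewrite (le_trans (mu_ge0 set0))//; apply: (ub_le_sup (supV r r0).2); exact: V0.
pose s := inf W.
have sV r : 0 < r -> s <= sup (V r) by move=> r0; apply: (ge_inf infW.2); exists r.
(* Summable, so that Borel-Cantelli sends the probability of the tail unions [T n] to 0; the same
   numbers measure how nearly [A k] attains [s]. *)
pose rr (k : nat) : R := 1 / (2 ^ k.+1)%:R.
have rr0 k : 0 < rr k by rewrite /rr divr_gt0// ltr0n expn_gt0.
have /choice[A AP] : forall k : nat, exists A, [/\ measurable A, (P A < (rr k)%:E)%E & s - rr k < mu A].
  move=> k; have [_ [A [mA PA] <-] lt] := sup_adherent (rr0 k) (supV _ (rr0 k)).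
  by exists A; split => //; rewrite (le_lt_trans _ lt)// lerB// sV.
have mA k : measurable (A k) by have [] := AP k.
pose T n := \bigcup_(j >= n) A j.
have mT j : measurable (T j) by apply: bigcup_measurable => k _; exact: mA.
have decT i j : (i <= j)%N -> T j `<=` T i.
  by move=> ij w [k /= jk Ak]; exists k => //=; exact: leq_trans jk.
have PT0 : P (T n) @[n --> \oo] --> 0%E.
  rewrite -(_ : P (lim_sup_set A) = 0%E).
    apply: lim_sup_set_cvg => //; rewrite (le_lt_trans (probability_le1 _ _)) ?ltry//.
    exact: mT.
  apply: lim_sup_set_cvg0 => //.
  apply: (@le_lt_trans _ _ 1%:E); last exact: ltry.
  rewrite (le_trans _ (@epsilon_trick0 R 1 xpredT ler01))//.
  by apply: lee_nneseries => // k _; apply: ltW; have [] := AP k.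
have PT e : 0 < e -> exists J : nat, forall j, (J <= j)%N -> (P (T j) < e%:E)%E.
  move=> e0; have /fine_cvgP[ff /cvgrPdist_lt /(_ e e0) H] := PT0.
  have [J _ JP] : \forall k \near \oo, P (T k) \is a fin_num /\ `|0 - fine (P (T k))| < e.
    by near=> k; split; near: k.
  exists J => j /JP[fj]; rewrite sub0r normrN ger0_norm ?fine_ge0// => je.
  by rewrite -(fineK fj) lte_fin.
have sT j : s <= mu (T j).
  apply/ler_addgt0Pl => e e0.
  have [k [jk ke]] : exists k, (j <= k)%N /\ rr k <= e.
    pose k := maxn j (Num.truncn e^-1).+1; exists k; split; first exact: leq_maxl.
    rewrite /rr div1r invf_ple ?posrE ?ltr0n ?expn_gt0//.
    rewrite (le_trans (ltW (truncnS_gt _)))// ler_nat.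
    rewrite (leq_trans (leq_maxr j _))// -/k.
    by rewrite (leq_trans (leqnSn _))// ltnW// ltn_expl.
  have [_ _ /ltW] := AP k; rewrite lerBlDl => /le_trans; apply.
  by apply: lerD => //; apply: mu_mono => w Aw; exists k.
exists T; split => // e e0.
have [_ [r r0 <-] sr] := inf_adherent e0 infW.
have r20 : 0 < r / 2 by rewrite divr_gt0.
exists (r / 2) => //; have [J JP] := PT _ r20; exists J => j jJ B mB PB.
(* [T j] already has mass at least [s], while its union with [B] has probability below [r] and hence
   mass below [s + e]; superadditivity leaves at most [e] for the rest of [B]. *)
have le1 : mu (B `\` T j) + mu (T j) <= mu (B `|` T j).
  rewrite (le_trans (mu_superadditive _ _ _))//; first exact: measurableD.
    by rewrite setDE -setIA setICl setI0.
  by apply: mu_mono => w [[]|]; [left|right].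
have le2 : mu (B `|` T j) <= sup (V r).
  apply: (ub_le_sup (supV _ r0).2); exists (B `|` T j) => //; split.
    exact: measurableU.
  rewrite (le_lt_trans (measureU2 _ _ _))//.
  by rewrite [X in (_ < X%:E)%E](splitr r) EFinD lteD// JP.
have := sT j; move: sr le1 le2; rewrite -/s; lra.
Unshelve. all: by end_near.
Qed.

End superadditive_concentration.

(** * Bounded functionals on bounded functions and the Yosida-Hewitt decomposition *)

Definition bounded_functional {d : measure_display} {Omega : measurableType d}
    {R : realType} (P : probability Omega R) (v : (Omega -> R) -> R) :=
  (forall (a : R) f g, bounded_measurable f -> bounded_measurable g ->
     v (fun w => a * f w + g w) = a * v f + v g) /\
  exists C : R, forall (M : R) f, bounded_measurable f ->
    {ae P, forall w, `|f w| <= M} -> `|v f| <= C * M.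

Section bounded_functionals.
Context {d : measure_display} {Omega : measurableType d} {R : realType}.
Variables (P : probability Omega R) (v : (Omega -> R) -> R).
Hypothesis vP : bounded_functional P v.
Implicit Types (u f g : Omega -> R) (A B : set Omega).
Local Notation L1 u := (P.-integrable setT (EFin \o u)).
Local Notation E u := (Rintegral P setT u).

Lemma bounded_functional0 : v (fun=> 0) = 0.
Proof.
have b0 := bounded_measurable_cst (Omega := Omega) (0 : R).
rewrite -[RHS](addNr (v (fun=> 0))) -[X in _ = X + _]mulN1r -vP.1//.
by congr v; apply/funext => w; rewrite mulr0 addr0.
Qed.

Lemma bounded_functionalD f g : bounded_measurable f -> bounded_measurable g ->
  v (fun w => f w + g w) = v f + v g.
Proof.
move=> bf bg; rewrite -[X in X + _]mul1r -vP.1//.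
by congr v; apply/funext => w; rewrite mul1r.
Qed.

Lemma bounded_functionalZ (a : R) f : bounded_measurable f ->
  v (fun w => a * f w) = a * v f.
Proof.
move=> bf; have b0 := bounded_measurable_cst (Omega := Omega) (0 : R).
rewrite -[RHS]addr0 -bounded_functional0 -vP.1//.
by congr v; apply/funext => w; rewrite addr0.
Qed.

Lemma bounded_functionalB f g : bounded_measurable f -> bounded_measurable g ->
  v (fun w => f w - g w) = v f - v g.
Proof.
move=> bf bg; rewrite -[X in _ + X]mulN1r addrC -vP.1//.
by congr v; apply/funext => w; rewrite mulN1r addrC.
Qed.

(** The bound in [bounded_functional] involves an almost sure [M]; taken at [M = 0] it makes [v]
    depend only on the class of its argument. *)
Lemma bounded_functional_ae f g : bounded_measurable f -> bounded_measurable g ->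
  {ae P, forall w, f w = g w} -> v f = v g.
Proof.
move=> bf bg fg; apply/eqP; rewrite -subr_eq0 -normr_le0 -bounded_functionalB//.
have [C CP] := vP.2; rewrite (le_trans (CP 0 _ _ _)) ?mulr0//.
- have := bounded_measurable_lin (-1) bg bf; congr bounded_measurable.
  by apply/funext => w; rewrite mulN1r addrC.
- by apply: filterS fg => w ->; rewrite subrr normr0.
Qed.

Definition unit_ball_on A : set (Omega -> R) :=
  [set f | [/\ bounded_measurable f, forall w, `|f w| <= 1 &
               forall w, ~ A w -> f w = 0]].

(** The total variation of [v] on [A]; no absolute value is needed because the unit ball is
    symmetric. *)
Definition functional_mass A : R := sup (v @` unit_ball_on A).

Lemma unit_ball_on0 A : unit_ball_on A (fun=> 0).
Proof. by split => //; [exact: bounded_measurable_cst|move=> w; rewrite normr0]. Qed.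

Lemma unit_ball_has_sup A : has_sup (v @` unit_ball_on A).
Proof.
split; first by exists (v (fun=> 0)); exists (fun=> 0) => //; exact: unit_ball_on0.
have [C CP] := vP.2; exists C => _ [f [bf f1 _] <-].
rewrite (le_trans (ler_norm _))// -[C]mulr1; apply: CP => //.
by apply/aeW.
Qed.

Lemma functional_mass_ub A f : unit_ball_on A f -> `|v f| <= functional_mass A.
Proof.
have H g : unit_ball_on A g -> v g <= functional_mass A.
  by move=> bg; apply: (ub_le_sup (unit_ball_has_sup A).2); exists g.
move=> [bf f1 fA]; rewrite ler_norml H ?andbT; last by split.
rewrite lerNl -mulN1r -bounded_functionalZ//; apply: H; split.
- have := bounded_measurable_lin (-1) bf (bounded_measurable_cst 0).
  by congr bounded_measurable; apply/funext => w; rewrite addr0.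
- by move=> w; rewrite mulN1r normrN.
- by move=> w /fA ->; rewrite mulr0.
Qed.

Lemma functional_mass_mono A B : A `<=` B -> functional_mass A <= functional_mass B.
Proof.
move=> AB; apply: ge_sup; first by have [] := unit_ball_has_sup A.
move=> _ [f [bf f1 fA] <-]; rewrite (le_trans (ler_norm _))//.
by apply: functional_mass_ub; split => // w nB; apply: fA => /AB.
Qed.

(** Functions in the unit ball carried by disjoint sets have their sum in the unit ball. *)
Lemma functional_mass_superadditive A B : A `&` B = set0 ->
  functional_mass A + functional_mass B <= functional_mass (A `|` B).
Proof.
move=> AB; rewrite -lerBrDr; apply: ge_sup; first by have [] := unit_ball_has_sup A.
move=> _ [f [bf f1 fA] <-]; rewrite lerBrDr -lerBrDl.
apply: ge_sup; first by have [] := unit_ball_has_sup B.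
move=> _ [g [bg g1 gB] <-]; rewrite lerBrDl -bounded_functionalD//.
rewrite (le_trans (ler_norm _))//; apply: functional_mass_ub; split.
- have := bounded_measurable_lin 1 bf bg; congr bounded_measurable.
  by apply/funext => w; rewrite mul1r.
- move=> w; have [Aw|/fA ->] := pselect (A w); last by rewrite add0r.
  rewrite gB ?addr0// => Bw; have : (A `&` B) w by [].
  by rewrite AB.
- by move=> w nAB; rewrite fA ?gB ?addr0//; apply: contra_not nAB; [right|left].
Qed.

Lemma functional_mass_ge0 A : 0 <= functional_mass A.
Proof. exact: le_trans (normr_ge0 _) (functional_mass_ub (unit_ball_on0 A)). Qed.

Lemma indicD A B w : \1_(A `\` B) w = \1_A w * \1_(~` B) w :> R.
Proof. by rewrite setDE indicI. Qed.

(** The concentration sets [T j] of the total variation absorb the singular part: off them small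
    sets carry little mass, so the values of [v] on indicators cut off by [T j] converge to an
    absolutely continuous [nu] with a density. Taking the limit in [j], instead of one fixed [j],
    gives a single [q] for all [e]. *)
Lemma yosida_hewitt : exists2 q, L1 q & forall e : R, 0 < e ->
  exists A, [/\ measurable A, (P A < e%:E)%E &
    forall f, bounded_measurable f -> (forall w, A w -> f w = 0) ->
      v f = E (fun w => q w * f w)].
Proof.
have [C CP] := vP.2.
have C0 : 0 <= C.
  rewrite -[C]mulr1 (le_trans (normr_ge0 (v (fun=> 0))))//; apply: CP.
    exact: bounded_measurable_cst.
  by apply/aeW => w; rewrite normr0.
have massC A : functional_mass A <= C.
  apply: ge_sup; first by have [] := unit_ball_has_sup A.
  move=> _ [f [bf f1 _] <-]; rewrite (le_trans (ler_norm _))// -[C]mulr1.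
  by apply: CP => //; apply/aeW.
have [T [mT decT PT smallT]] := concentration_sets P functional_mass_ge0 massC
  functional_mass_mono (fun A B _ _ => @functional_mass_superadditive A B).
have b1 A : measurable A -> bounded_measurable (\1_A : Omega -> R).
  exact: bounded_measurable_indic.
have mD B j : measurable B -> measurable (B `\` T j) by move=> mB; exact: measurableD.
have ball1 A B : measurable A -> A `<=` B -> unit_ball_on B \1_A.
  move=> mA AB; split; [exact: b1|exact: indic_norm_le1|move=> w nB].
  by rewrite indicE memNset// => /AB.
have vU A B : measurable A -> measurable B -> A `&` B = set0 ->
    v \1_(A `|` B) = v \1_A + v \1_B.
  move=> mA mB AB; rewrite -bounded_functionalD; [|exact: b1..].
  congr v; apply/funext => w.
  rewrite !indicE in_setU; have [wA|wA] := boolP (w \in A); have [wB|wB] := boolP (w \in B);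
    rewrite ?addr0 ?add0r//.
  by move: wA wB; rewrite !inE => wA wB; have : (A `&` B) w by []; rewrite AB.
pose vT B j := v \1_(B `\` T j).
have cvT B : measurable B -> cvg (vT B @ \oo).
  move=> mB; apply/cauchy_cvgP/cauchy_exP => e e0.
  have e20 : 0 < e / 2 by rewrite divr_gt0.
  have [r r0 [J JP]] := smallT _ e20.
  have [K KP] := PT _ r0.
  pose i := maxn J K; exists (vT B i); exists i => // j /= ij.
  (* The increment is carried by [T i] without [T j]: [T i] has small probability, and once [T j] is
     removed small sets have little mass. *)
  have -> : vT B j = vT B i + v \1_((B `&` T i) `\` T j).
    rewrite -vU; [|exact: mD|by apply: mD; exact: measurableI|].
      congr v; congr indic; apply/seteqP; split => w.
        by move=> [Bw Tj]; have [Ti|Ti] := pselect (T i w); [right|left].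
      by move=> [[Bw Ti]|[[Bw _] Tj]]; split => // Tj; apply: Ti; exact: decT Tj.
    by apply/seteqP; split => // w [[_ Ti] [[_ /Ti]]].
  rewrite -ball_normE /= opprD addrA subrr add0r normrN.
  have le1 := functional_mass_ub (ball1 _ _ (mD _ j (measurableI _ _ mB (mT i))) (@subset_refl _ _)).
  rewrite (le_lt_trans le1)// (@le_lt_trans _ _ (e / 2))//; last by rewrite ltr_pdivrMr// ltr_pMr// ltr1n.
  apply: (@le_trans _ _ (functional_mass (T i `\` T j))).
    by apply: functional_mass_mono => w [[]].
  by apply: JP => //; [rewrite (leq_trans _ ij)// leq_maxl|apply: KP; exact: leq_maxr].
pose nu B := lim (vT B @ \oo).
have nuD A B : measurable A -> measurable B -> A `&` B = set0 ->
    nu (A `|` B) = nu A + nu B.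
  move=> mA mB AB; apply/cvg_lim => //.
  have -> : vT (A `|` B) = (vT A \+ vT B)%R.
    apply/funext => j /=; rewrite /vT setDUl vU//; [exact: mD|exact: mD|].
    by apply/seteqP; split => // w [[Aw _] [Bw _]]; have : (A `&` B) w by []; rewrite AB.
  by apply: cvgD; exact: cvT.
have nu_ac e : 0 < e -> exists2 r : R, 0 < r &
    forall A, measurable A -> (P A < r%:E)%E -> `|nu A| <= e.
  move=> e0; have [r r0 [J JP]] := smallT _ e0; exists r => // A mA PA.
  have H : \forall j \near \oo, `|vT A j| <= e.
    exists J => // j /= Jj; apply: le_trans (JP j Jj A mA PA).
    by apply: functional_mass_ub; apply: ball1 => //; exact: mD.
  rewrite ler_norml; apply/andP; split.
    apply: limr_ge; first exact: cvT.
    by apply: filterS H => j; rewrite ler_norml => /andP[].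
  apply: limr_le; first exact: cvT.
  by apply: filterS H => j; rewrite ler_norml => /andP[].
have [q [_ iq qP]] := radon_nikodym_sub (@sigma_algebra_measurable _ Omega)
  (@subset_refl _ _) nuD nu_ac.
exists q => // e e0; have [J JP] := PT _ e0.
exists (T J); split => //; first exact: JP.
have bCT : bounded_measurable (\1_(~` T J) : Omega -> R) by apply: b1; exact: measurableC.
(* The cut-off by the complement of [T J] is put inside [Q], so that [Q] can hold for all bounded
   functions and be proved by approximation. *)
pose Q f := bounded_measurable f /\
  v (fun w => f w * \1_(~` T J) w) = E (fun w => q w * (f w * \1_(~` T J) w)).
suff HQ f : bounded_measurable f -> Q f.
  move=> f bf f0; have [_] := HQ f bf.
  have fE w : f w * \1_(~` T J) w = f w.
    rewrite indicE in_setC; have [/set_mem wT|wT] := boolP (w \in T J).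
      by rewrite f0// mul0r.
    by rewrite mulr1.
  rewrite (_ : (fun w => f w * _) = f); last exact/funext.
  by move=> ->; apply: E_ext => w; rewrite fE.
move=> [mf fM].
apply: (bounded_measurable_ind (@sigma_algebra_measurable _ Omega) _ _ _ _ fM).
- move=> A mA; split; first exact: b1.
  have mAT := mD A J mA.
  have -> : (fun w => \1_A w * \1_(~` T J) w) = (\1_(A `\` T J) : Omega -> R).
    by apply/funext => w; rewrite indicD.
  have -> : E (fun w => q w * (\1_A w * \1_(~` T J) w)) =
      E (fun w => q w * \1_(A `\` T J) w) by apply: E_ext => w; rewrite indicD.
  (* For [j >= J] the set [T j] lies inside [T J], so the sequence defining [nu] is already
     constant. *)
  rewrite qP//; apply/esym/cvg_lim => //; apply: cvg_near_cst.
  exists J => // j /= Jj; congr v; congr indic; apply/seteqP; split => w.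
    by move=> [].
  by move=> [Aw Tj]; split => //; apply: contra_not Tj; exact: decT.
- move=> a g k [bg vg] [bk vk]; split; first exact: bounded_measurable_lin.
  have [bg' bk'] := (bounded_measurableM bg bCT, bounded_measurableM bk bCT).
  have -> : (fun w => (a * g w + k w) * \1_(~` T J) w) =
      (fun w => a * (g w * \1_(~` T J) w) + k w * \1_(~` T J) w).
    by apply/funext => w; rewrite mulrDl mulrA.
  rewrite vP.1// vg vk -EZ; last exact: L1_mul_bounded.
  rewrite -ED; [|by apply: L1Z; exact: L1_mul_bounded|exact: L1_mul_bounded].
  by apply: E_ext => w; ring.
- move=> g mg gM gQ.
  have bg : bounded_measurable g.
    by split => //; apply: (measurable_wrt_measurable (@subset_refl _ _) mg).
  split => //; apply/eqP; rewrite -subr_eq0 -normr_le0; apply/ler_addgt0Pl => r r0.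
  rewrite addr0; pose K := C + E (fun w => `|q w|) + 1.
  have Eq0 : 0 <= E (fun w => `|q w|) by apply: Rintegral_ge0.
  have K0 : 0 < K by rewrite ltr_wpDl// addr_ge0.
  have [|k [bk vk] gk] := gQ (r / K); first by rewrite divr_gt0.
  have bgk : bounded_measurable (fun w => g w - k w).
    have := bounded_measurable_lin (-1) bk bg; congr bounded_measurable.
    by apply/funext => w; rewrite mulN1r addrC.
  have [bg' bk'] := (bounded_measurableM bgk bCT, bounded_measurableM bk bCT).
  have gkr w : `|(g w - k w) * \1_(~` T J) w| <= r / K.
    by rewrite normrM -[leRHS]mulr1 ler_pM// indic_norm_le1.
  have -> : (fun w => g w * \1_(~` T J) w) =
      (fun w => (g w - k w) * \1_(~` T J) w + k w * \1_(~` T J) w).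
    by apply/funext => w; rewrite -mulrDl subrK.
  rewrite bounded_functionalD// vk.
  rewrite (_ : E (fun w => q w * (g w * _)) = E (fun w => q w * ((g w - k w) * \1_(~` T J) w)) +
     E (fun w => q w * (k w * \1_(~` T J) w))); last first.
    rewrite -ED; [|exact: L1_mul_bounded..].
    by apply: E_ext => w; rewrite -mulrDr -mulrDl subrK.
  rewrite opprD addrACA subrr addr0 (le_trans (ler_normB _ _))//.
  have h1 : `|v (fun w => (g w - k w) * \1_(~` T J) w)| <= C * (r / K).
    by apply: CP => //; apply/aeW.
  have h2 := E_norm_le_bounded iq bg'.1 gkr.
  rewrite (le_trans (lerD h1 h2))// mulrC -mulrDr mulrAC ler_pdivrMr// ler_pM2l//.
  by rewrite /K lerDl.
- by move=> B mB; rewrite -[X in measurable X]setTI; exact: mf.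
Qed.

End bounded_functionals.

(** * Measurability of a normal integrand along a measurable function *)

Section integrand_measurability.
Context {d : measure_display} {Omega : measurableType d} {R : realType} {m : nat}.
Implicit Types (h : 'rV[R]_m -> Omega -> \bar R) (x : Omega -> 'rV[R]_m).

Lemma rational_row_dense (a : 'rV[R]_m) (e : R) : 0 < e ->
  exists q : 'rV[rat]_m, ball (\row_i ratr (q 0 i) : 'rV[R]_m) e a.
Proof.
move=> e0.
have /choice[q qP] : forall i, exists q : rat, ball (ratr q : R) e (a 0 i).
  move=> i; have [|q] := @rat_in_itvoo R (a 0 i - e) (a 0 i + e).
    by rewrite ltrBlDr -addrA ltrDl addr_gt0.
  rewrite in_itv/= => /andP[q1 q2]; exists q; rewrite -ball_normE/= ltr_norml.
  by apply/andP; split; lra.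
exists (\row_i q i); split => // i j; rewrite !mxE (ord1 i).
exact: qP.
Qed.

Lemma measurable_row_ball x (b : 'rV[R]_m) (e : R) : 0 < e ->
  (forall i, measurable_fun setT (fun w => x w 0 i)) ->
  measurable [set w | ball b e (x w)].
Proof.
move=> e0 mx.
have -> : [set w | ball b e (x w)] =
   \bigcap_(i in [set: 'I_m]) ((fun w => x w 0 i) @^-1` ball (b 0 i) e).
  apply/seteqP; split => w /=.
    by move=> [_ H] i _ /=; exact: H.
  by move=> H; split => // i j; rewrite (ord1 i); exact: H.
apply: fin_bigcap_measurable => // i _.
rewrite -[X in measurable X]setTI; apply: mx => //.
exact: measurable_ball.
Qed.

(** [h (x w) w <= a] says that [(x w, a)] belongs to the closed epigraph, that is, has epigraph
    points arbitrarily near. Testing this with balls around rational centres expresses the sublevel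
    set by countably many hitting sets of open sets. *)
Lemma normal_integrand_measurable h x : normal_integrand h ->
  (forall i, measurable_fun setT (fun w => x w 0 i)) ->
  measurable_fun setT (fun w => h (x w) w).
Proof.
move=> [hcl hm] mx.
apply: (measurability _ (ErealGenOInfty.measurableE R)) => _ [_ [a ->] <-].
rewrite setTI -[X in measurable X]setCK; apply: measurableC.
have -> : ~` ((fun w => h (x w) w) @^-1` `]a%:E, +oo[) =
  \bigcap_k \bigcup_(q : 'rV[rat]_m)
   ([set w | ball (\row_i ratr (q 0 i) : 'rV[R]_m) (k.+1%:R^-1) (x w)] `&`
    [set w | epi h w `&` ball ((\row_i ratr (q 0 i), a) : 'rV[R]_m * R) (k.+1%:R^-1)
      !=set0]).
  apply/seteqP; split => w /=.
    rewrite in_itv/= andbT => /negP; rewrite -leNgt => hw k _.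
    have k0 : (0 : R) < k.+1%:R^-1 by rewrite invr_gt0.
    have [q qP] := rational_row_dense (x w) k0.
    by exists q => //; split => //; exists (x w, a); split => //; split => //=; exact: ballxx.
  move=> H; rewrite in_itv/= andbT; apply/negP; rewrite -leNgt.
  have -> : (h (x w) w <= a%:E)%E = ((epi h w) (x w, a)) :> Prop by [].
  rewrite ((closure_id (epi h w)).1 (hcl w)) => B /nbhs_ballP[e /= e0 eB].
  (* Two radii: one from [x w] to the rational centre, one from the centre to the epigraph point. *)
  have [k ke] : exists k : nat, k.+1%:R^-1 + k.+1%:R^-1 <= e.
    exists (Num.truncn (2 / e)); set k := (_ : nat).+1.
    have k0 : (0 : R) < k%:R by rewrite ltr0n.
    have : 2 / e < k%:R by exact: truncnS_gt.
    rewrite ltr_pdivrMr// => ke; have : 2 / k%:R <= e by rewrite ler_pdivrMr// mulrC ltW.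
    lra.
  have k0 : (0 : R) < k.+1%:R^-1 by rewrite invr_gt0.
  have [q _ [xq [[y b] [eyb [/= yq yb]]]]] := H k I.
  exists (y, b); split => //; apply: eB; apply: (le_ball ke); split => /=.
    by apply: ball_triangle yq; exact: ball_sym.
  by apply: (le_ball _ yb); rewrite lerDl ltW.
apply: bigcapT_measurable => k; apply: countable_bigcupT_measurable => [|q].
  exact: countableP.
apply: measurableI; first by apply: measurable_row_ball => //; rewrite invr_gt0.
by apply: hm; exact: ball_open.
Qed.

End integrand_measurability.

(** * Integrability of the integrand and gluing of functions *)

Section integrand_expectation.
Context {d : measure_display} {Omega : measurableType d} {R : realType} {m : nat}.
Variables (P : probability Omega R) (h : 'rV[R]_m -> Omega -> \bar R).
Hypothesis hN : normal_integrand h.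
Implicit Types (x y z : Omega -> 'rV[R]_m) (A : set Omega).
Local Notation L1 u := (P.-integrable setT (EFin \o u)).
Local Notation E u := (Rintegral P setT u).

Definition measurable_row x := forall i, measurable_fun setT (fun w => x w 0 i).

Definition bounded_row x := forall i, bounded_measurable (fun w => x w 0 i).

Lemma bounded_row_measurable x : bounded_row x -> measurable_row x.
Proof. by move=> bx i; have [] := bx i. Qed.

Lemma expect_lty (f : Omega -> \bar R) : measurable_fun setT f ->
  (expect P f < +oo)%E = (\int[P]_w f^\+ w < +oo)%E.
Proof.
move=> mf; rewrite /expect; case: ifPn => // fp; rewrite integralE.
rewrite (le_lt_trans _ fp)// geeDl// oppe_le0; exact: integral_ge0.
Qed.

(** A value below [+oo] controls the positive part; being different from [-oo] then controls the
    negative part. *)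
Lemma expect_integrable (f : Omega -> \bar R) : measurable_fun setT f ->
  (expect P f < +oo)%E -> expect P f != -oo%E -> P.-integrable setT f.
Proof.
move=> mf fy fNy; have := fy; rewrite expect_lty// => fp.
move: fy fNy; rewrite /expect fp integralE => _ fNy.
apply/integrableP; split => //.
under eq_integral do rewrite -/((abse \o f) _) fune_abse.
rewrite ge0_integralD//; [|exact: measurable_funepos|exact: measurable_funeneg].
rewrite lte_add_pinfty//; apply: contraNT fNy; rewrite -leNgt leye_eq => /eqP ->.
have : (\int[P]_w f^\+ w)%E \is a fin_num by rewrite ge0_fin_numE// integral_ge0.
by case: (\int[P]_w f^\+ w)%E.
Qed.

Lemma fine_L1 (f : Omega -> \bar R) : P.-integrable setT f -> L1 (fine \o f).
Proof.
move=> /[dup] iF /integrableP[mf fy]; apply/integrableP; split.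
  by apply/measurable_EFinP; apply: measurableT_comp.
apply: le_lt_trans fy; apply: ge0_le_integral => //.
- by apply: measurableT_comp => //; apply/measurable_EFinP; apply: measurableT_comp.
- by apply: measurableT_comp.
- by move=> w _ /=; case: (f w) => //= *; rewrite ?normr0 ?leey.
Qed.

Lemma integrable_expectE (f : Omega -> \bar R) : P.-integrable setT f ->
  expect P f = (E (fine \o f))%:E.
Proof.
move=> /[dup] iF /integrableP[mf fy].
rewrite /expect integral_funepos_lt_pinfty//.
rewrite -integral_L1; last exact: fine_L1.
apply: ae_eq_integral => //.
  by apply/measurable_EFinP; apply: measurableT_comp.
by apply: filterS (integrable_ae measurableT iF) => w /(_ I) fw _ /=; rewrite fineK.
Qed.

Definition glue A x y : Omega -> 'rV[R]_m := fun w => if w \in A then y w else x w.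

Lemma measurable_fun_glue d' (T' : measurableType d') A (f g : Omega -> T') :
  measurable A -> measurable_fun setT f -> measurable_fun setT g ->
  measurable_fun setT (fun w => if w \in A then g w else f w).
Proof.
move=> mA mf mg; apply: measurable_fun_ifT => //.
apply: (measurable_fun_bool true); rewrite setTI.
rewrite (_ : _ @^-1` _ = A)//; apply/seteqP; split => w /=; first exact: set_mem.
exact: mem_set.
Qed.

(** Since [x] only has to be bounded off [A], gluing also serves to truncate an unbounded [x]. *)
Lemma bounded_row_glue A x y (M : R) : measurable A -> measurable_row x ->
  (forall w i, ~ A w -> `|x w 0 i| <= M) -> bounded_row y -> bounded_row (glue A x y).
Proof.
move=> mA mx xM by_ i; split.
  rewrite (_ : (fun w => _) = (fun w => if w \in A then y w 0 i else x w 0 i)).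
    by apply: measurable_fun_glue => //; exact: (by_ i).1.
  by apply/funext => w; rewrite /glue; case: ifP.
have [_ [K yK]] := by_ i; exists (`|M| + `|K|) => w; rewrite /glue; case: ifPn => wA.
  by rewrite (le_trans (yK w))// (le_trans (ler_norm _))// lerDr.
rewrite (le_trans (xM w i _))//; first by move: wA; rewrite notin_setE.
by rewrite (le_trans (ler_norm _))// lerDl.
Qed.

Lemma integrand_glue A x y w : h (glue A x y w) w = if w \in A then h (y w) w else h (x w) w.
Proof. by rewrite /glue; case: ifP. Qed.

End integrand_expectation.

(** * Orthogonality to unbounded adapted processes *)

Section orthogonality.
Context {d : measure_display} {Omega : measurableType d} {R : realType}.
Variables (P : probability Omega R) (T m : nat) (tau : 'I_m -> 'I_T.+1).
Variable F : 'I_T.+1 -> set (set Omega).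
Hypothesis hF : filtration F.
Local Notation L1 u := (P.-integrable setT (EFin \o u)).
Local Notation E u := (Rintegral P setT u).
Implicit Types (p x : 'I_m -> Omega -> R).

Lemma measurable_wrt_le (s t : 'I_T.+1) (f : Omega -> R) : (s <= t)%N ->
  measurable_wrt (F s) f -> measurable_wrt (F t) f.
Proof. by move=> st mf B mB; have [_ _ /(_ _ _ st)] := hF; apply; exact: mf. Qed.

Lemma E_compl_small (u : Omega -> R) (B : nat -> set Omega) : L1 u ->
  (forall k, measurable (B k)) -> nondecreasing_seq B -> (forall w, exists k, B k w) ->
  forall e : R, 0 < e -> exists k, E (fun w => `|u w| * \1_(~` B k) w) <= e.
Proof.
move=> iu mB ndB cB e e0; have [r r0 rP] := E_absolutely_continuous iu e0.
have [k Pk] := prob_lt_compl_bigcup P mB ndB cB r0.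
by exists k; apply: rP => //; exact: measurableC.
Qed.

(** [tau i] is the time of coordinate [i] in the flattened vector, so orthogonality can be tested
    one coordinate at a time. *)
Definition orthogonal_to_adapted p := forall i (y : Omega -> R),
  measurable_wrt (F (tau i)) y -> (exists M : R, forall w, `|y w| <= M) ->
  E (fun w => p i w * y w) = 0.

(* Truncating [x] at time [t] makes the time-[t] term bounded, hence of zero mean,
   so the later terms inherit an integrable upper bound; then let the truncation
   level tend to infinity. *)
Lemma orthogonal_unbounded p : (forall i, L1 (p i)) -> orthogonal_to_adapted p ->
  forall x, (forall i, measurable_wrt (F (tau i)) (x i)) ->
  forall u, L1 u -> (forall w, \sum_i p i w * x i w <= u w) ->
  L1 (fun w => \sum_i p i w * x i w) /\ E (fun w => \sum_i p i w * x i w) = 0.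
Proof.
have [sF FM Fnd] := hF => ip op.
(* [k] counts the final periods in which [x] may be nonzero; each induction step removes the
   earliest of them. *)
suff H k : forall x, (forall i, measurable_wrt (F (tau i)) (x i)) ->
  (forall i, (tau i + k < T.+1)%N -> x i = fun=> 0) ->
  forall u, L1 u -> (forall w, \sum_i p i w * x i w <= u w) ->
  L1 (fun w => \sum_i p i w * x i w) /\ E (fun w => \sum_i p i w * x i w) = 0.
  move=> x mx u iu xu; apply: (H T.+1 x mx _ u iu xu) => i.
  by rewrite ltnNge leq_addl.
elim: k => [|k IH] x mx x0 u iu xu.
  have -> : (fun w => \sum_i p i w * x i w) = (fun=> 0).
    apply/funext => w; apply: big1 => i _; rewrite x0 ?mulr0// addn0.
    exact: ltn_ord.
  by split; [apply/bounded_measurable_L1/bounded_measurable_cst|exact: E_cst].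
pose now i := (tau i + k.+1 == T.+1)%N.
pose r w : R := \sum_(i | now i) `|x i w|.
(* The truncation level depends on the earliest active period only, so the sets [B l] are known at
   all active times and cutting by them preserves adaptedness. *)
have mr i : (T.+1 <= tau i + k.+1)%N -> measurable_wrt (F (tau i)) r.
  move=> ti; apply: (measurable_wrt_sum (sF _)) => j /eqP jT.
  apply: (measurable_wrt_comp (sF _) (g := Num.norm)); first exact: normr_measurable.
  by apply: measurable_wrt_le (mx j); rewrite -(leq_add2r k.+1) jT.
have r0 w : 0 <= r w by apply: sumr_ge0.
have mr' : measurable_fun setT r.
  apply: (measurable_wrt_measurable (@subset_refl _ _)).
  apply: (measurable_wrt_sum (@sigma_algebra_measurable _ Omega)) => i _ C mC.
  rewrite -[X in measurable X]setTI; apply: measurableT_comp => //.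
  exact: (measurable_wrt_measurable (FM _) (mx i)).
pose B (k : nat) := [set w | `|r w| <= k%:R].
have [mB ndB cB] := norm_sublevel_cover mr'.
have GB i l : (T.+1 <= tau i + k.+1)%N -> F (tau i) (B l).
  move=> ti; have := mr i ti (Num.norm @^-1` [set` `]-oo, l%:R]]).
  move=> /(_ _)/wrap[].
    rewrite -[X in measurable X]setTI.
    by apply: (@normr_measurable R setT) => //; exact: measurable_itv.
  by congr (F _ _); apply/seteqP; split => w /=; rewrite in_itv.
have mx1 i l : measurable_wrt (F (tau i)) (fun w => x i w * \1_(B l) w).
  have [ti|ti] := ltnP (tau i + k.+1) T.+1.
    rewrite x0// (_ : (fun w => _) = fun=> 0); first exact: measurable_wrt_cst.
    by apply/funext => w; rewrite mul0r.
  by apply: measurable_wrtM => //; apply: measurable_wrt_indic => //; exact: GB.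
pose s w := \sum_i p i w * x i w.
have ms : measurable_fun setT s.
  apply: measurable_sum => i; apply: measurable_funM; first exact: L1_measurable.
  exact: (measurable_wrt_measurable (FM _) (mx i)).
have trunc l : L1 (fun w => s w * \1_(B l) w) /\ E (fun w => s w * \1_(B l) w) = 0.
  pose x1 i w := if now i then x i w * \1_(B l) w else 0.
  pose x2 i w := if now i then 0 else x i w * \1_(B l) w.
  have mx1' i : measurable_wrt (F (tau i)) (x1 i).
    by rewrite /x1; case: (now i) => //; exact: measurable_wrt_cst.
  have mx2 i : measurable_wrt (F (tau i)) (x2 i).
    by rewrite /x2; case: (now i) => //; exact: measurable_wrt_cst.
  have x1l i w : `|x1 i w| <= l%:R.
    rewrite /x1; case: ifPn => ni; last by rewrite normr0.
    rewrite indicE; have [/set_mem|_] := boolP (w \in B l); last by rewrite mulr0 normr0.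
    rewrite /B/= ger0_norm// mulr1; apply: le_trans.
    by rewrite /r (bigD1 i)//= lerDl sumr_ge0.
  have bx1 i : bounded_measurable (x1 i).
    by split; [exact: (measurable_wrt_measurable (FM _) (mx1' i))|exists l%:R].
  have i1 i : L1 (fun w => p i w * x1 i w) by exact: L1_mul_bounded.
  have is1 : L1 (fun w => \sum_i p i w * x1 i w) by apply: L1_sum => i; exact: i1.
  have Es1 : E (fun w => \sum_i p i w * x1 i w) = 0.
    by rewrite E_sum//; apply: big1 => i _; apply: op => //; exists l%:R.
  have sE w : s w * \1_(B l) w = \sum_i p i w * x1 i w + \sum_i p i w * x2 i w.
    rewrite -big_split/= mulr_suml; apply: eq_bigr => i _.
    by rewrite /x1 /x2; case: ifP => _; rewrite mulr0 ?addr0 ?add0r mulrA.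
  have [|||is2 Es2] := IH x2 mx2 _ (fun w => `|u w| + `|\sum_i p i w * x1 i w|) _ _.
  - move=> i ti; apply/funext => w; rewrite /x2; case: ifPn => // ni.
    by rewrite x0 ?mul0r// ltn_neqAle ni addnS.
  - by apply: L1D; exact: L1_norm.
  - move=> w; have -> : \sum_i p i w * x2 i w = s w * \1_(B l) w - \sum_i p i w * x1 i w.
      by rewrite sE addrAC subrr add0r.
    apply: lerD; last by rewrite -normrN ler_norm.
    rewrite indicE; case: (_ \in _); rewrite ?mulr1 ?mulr0//.
    exact: le_trans (xu w) (ler_norm _).
  rewrite (_ : (fun w => s w * _) = (fun w => \sum_i p i w * x1 i w + \sum_i p i w * x2 i w)).
    by split; [exact: L1D|rewrite ED// Es1 Es2 addr0].
  exact/funext.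
(* From [s <= |u|] follows [|s| <= 2 |u| - s], and [s] has zero mean on [B l]; this gives the bound
   uniform in [l]. *)
have is_ : L1 (fun w => `|s w|).
  apply: (@L1_bounded_exhaustion _ _ _ P _ B (2 * E (fun w => `|u w|))) => //.
  - exact: measurableT_comp.
  - move=> l; have [il _] := trunc l; apply: L1_le (L1_norm il) _.
      by apply: measurable_funM; [exact: measurableT_comp|exact/measurable_indic/mB].
    by move=> w; rewrite !normrM normr_id.
  - move=> l; have [il El] := trunc l.
    rewrite -[leRHS]subr0 -El -EZ; last exact: L1_norm.
    rewrite -EB//; last by apply: L1Z; exact: L1_norm.
    apply: E_le.
    + apply: L1_le (L1_norm il) _.
        by apply: measurable_funM; [exact: measurableT_comp|exact/measurable_indic/mB].
      by move=> w; rewrite !normrM normr_id.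
    + by apply: L1B => //; apply: L1Z; exact: L1_norm.
    + move=> w; have := xu w; rewrite -/(s w) indicE.
      have := ler_norm (u w); have := normr_ge0 (u w).
      case: (_ \in _); rewrite ?mulr1 ?mulr0 ?subr0.
        case: (ger0P (s w)); lra.
      by rewrite mulr_ge0.
have iss : L1 s.
  by apply: L1_le is_ _ => // w; rewrite lexx.
split => //; apply/eqP; rewrite -normr_le0; apply/ler_addgt0Pl => e e0; rewrite addr0.
have [l le] := E_compl_small iss mB ndB cB e0.
have [il El] := trunc l; apply: le_trans le.
have mCB : measurable (~` B l) by apply: measurableC; exact: mB.
rewrite -/s (_ : E s = E (fun w => s w * \1_(~` B l) w)); last first.
  rewrite -[RHS]addr0 -El -ED//; last exact: L1_indic.
  apply: E_ext => w; rewrite -mulrDr !indicE in_setC.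
  by case: (_ \in _); rewrite /= ?addr0 ?add0r mulr1.
rewrite (le_trans (E_norm_le (L1_indic mCB iss)))// le_eqVlt; apply/orP; left.
by apply/eqP/E_ext => w; rewrite normrM [X in _ * X]ger0_norm// indicE; case: (_ \in _).
Qed.

End orthogonality.

(** * Extension of the dual bound to unbounded adapted processes *)

Section extension_to_unbounded.
Context {d : measure_display} {Omega : measurableType d} {R : realType}.
Variables (P : probability Omega R) (T m : nat) (tau : 'I_m -> 'I_T.+1).
Variable F : 'I_T.+1 -> set (set Omega).
Hypothesis hF : filtration F.
Variable h : 'rV[R]_m -> Omega -> \bar R.
Hypothesis hN : normal_integrand h.
Local Notation L1 u := (P.-integrable setT (EFin \o u)).
Local Notation E u := (Rintegral P setT u).
Implicit Types (x y z : Omega -> 'rV[R]_m).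

Hypothesis Eh_gtNy : forall z, bounded_row z -> Eh P h z != -oo%E.
Variable z0 : Omega -> 'rV[R]_m.
Hypotheses (bz0 : bounded_row z0) (Ehz0 : (Eh P h z0 < +oo)%E).

Lemma Eh_lty_integrable z : bounded_row z -> (Eh P h z < +oo)%E ->
  P.-integrable setT (fun w => h (z w) w).
Proof.
move=> bz Ez; apply: expect_integrable => //; last exact: Eh_gtNy.
by apply: normal_integrand_measurable => //; exact: bounded_row_measurable.
Qed.

Variables (p : 'I_m -> Omega -> R) (c : R).
Hypotheses (ip : forall i, L1 (p i)) (op : orthogonal_to_adapted P tau F p).
Hypothesis pc : forall z, bounded_row z ->
  ((\sum_i E (fun w => p i w * z w 0 i) - c)%:E <= Eh P h z)%E.

(* No measurable selection is needed: it is enough to compare [x + z] with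
   the bounded function that equals it where it is small and [z0] elsewhere. *)
Lemma dual_bound_unbounded x z :
  (forall i, measurable_wrt (F (tau i)) (fun w => x w 0 i)) -> measurable_row z ->
  (forall i, L1 (fun w => p i w * z w 0 i)) ->
  ((\sum_i E (fun w => p i w * z w 0 i) - c)%:E <= Eh P h (x + z)%R)%E.
Proof.
have [_ FM _] := hF => ax mz ipz.
set y : Omega -> 'rV[R]_m := x + z.
have yE w i : y w 0 i = x w 0 i + z w 0 i by rewrite /y !mxE.
have my : measurable_row y.
  move=> i; rewrite (_ : (fun w => _) = fun w => x w 0 i + z w 0 i); last first.
    by apply/funext => w; rewrite yE.
  by apply: measurable_funD => //; exact: (measurable_wrt_measurable (FM _) (ax i)).
pose H (z : Omega -> 'rV[R]_m) w := h (z w) w.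
have mH u : measurable_row u -> measurable_fun setT (H u).
  by move=> mu; exact: normal_integrand_measurable.
have [Hy|] := boolP (Eh P h y < +oo)%E; last first.
  by rewrite -leNgt leye_eq => /eqP ->; rewrite leey.
have Hyp : (\int[P]_w (H y)^\+ w < +oo)%E by move: Hy; rewrite /Eh expect_lty//; exact: mH.
have iH0 : P.-integrable setT (H z0) by exact: Eh_lty_integrable.
pose nrm w : R := \sum_i `|y w 0 i|.
have mnrm : measurable_fun setT nrm.
  by apply: measurable_sum => i; apply: measurableT_comp => //; exact: my.
have nrm0 w : 0 <= nrm w by apply: sumr_ge0.
have [mB ndB cB] := norm_sublevel_cover mnrm.
pose B (k : nat) := [set w | `|nrm w| <= k%:R].
pose r w := fine (H y w); pose r0 w := fine (H z0 w).
have ir0 : L1 r0 by exact: fine_L1.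
pose dot (z : Omega -> 'rV[R]_m) w : R := \sum_i p i w * z w 0 i.
have mdot u : measurable_row u -> measurable_fun setT (dot u).
  move=> mu; apply: measurable_sum => i; apply: measurable_funM => //.
  exact: L1_measurable (ip i).
have idot u : bounded_row u -> L1 (dot u).
  by move=> bu; apply: L1_sum => i; exact: L1_mul_bounded.
have Edot (u : Omega -> 'rV[R]_m) : (forall i, L1 (fun w => p i w * u w 0 i)) ->
    E (dot u) = \sum_i E (fun w => p i w * u w 0 i) by move=> iu; rewrite E_sum.
pose g w := r w - dot y w; pose g0 w := r0 w - dot z0 w.
have ig0 : L1 g0 by apply: L1B => //; exact: idot.
have mr : measurable_fun setT r by apply: measurableT_comp => //; exact: mH.
have mg : measurable_fun setT g by apply: measurable_funB => //; exact: mdot.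
(* The dual bound at the function equal to [y] on [A] and to [z0] elsewhere. [A] stays free: all of
   [B k] for the limit, and the part of [B k] where [g < 0] to control the negative part of [g]. *)
have main k A : measurable A -> A `<=` B k ->
  [/\ {ae P, forall w, A w -> H y w \is a fin_num}, L1 (fun w => g w * \1_A w) &
     - c <= E (fun w => g w * \1_A w) + E (fun w => g0 w * \1_(~` A) w)].
  move=> mA AB; have mCA : measurable (~` A) by exact: measurableC.
  pose yA := glue (~` A) y z0.
  have byA : bounded_row yA.
    apply: (bounded_row_glue (M := k%:R)) => // w i /contrapT /AB.
    rewrite /B /= ger0_norm//; apply: le_trans.
    by rewrite /nrm (bigD1 i)//= lerDl sumr_ge0.
  have HE w : H yA w = if w \in A then H y w else H z0 w.
    by rewrite /H integrand_glue in_setC; case: (w \in A).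
  have iyA : P.-integrable setT (H yA).
    apply: Eh_lty_integrable => //; rewrite /Eh expect_lty; last first.
      by apply: mH; exact: bounded_row_measurable.
    apply: (@le_lt_trans _ _ (\int[P]_w ((H y)^\+ w + (H z0)^\+ w))%E).
      apply: ge0_le_integral => //.
      - by apply: measurable_funepos; apply: mH; exact: bounded_row_measurable.
      - apply: emeasurable_funD; apply: measurable_funepos; first exact: mH.
        by apply: mH; exact: bounded_row_measurable.
      - move=> w _; rewrite !funeposE -/(H yA w) HE.
        by case: ifP => _; [apply: leeDl|apply: leeDr]; rewrite le_max lexx orbT.
    rewrite ge0_integralD//; [|by apply: measurable_funepos; exact: mH
      |by apply: measurable_funepos; apply: mH; exact: bounded_row_measurable].
    by rewrite lte_add_pinfty// integral_funepos_lt_pinfty.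
  have irA := fine_L1 iyA.
  have gE w : fine (H yA w) - dot yA w = g w * \1_A w + g0 w * \1_(~` A) w.
    rewrite HE !indicE in_setC /dot /yA /glue in_setC.
    by case: (w \in A); rewrite /= ?mulr1 ?mulr0 ?addr0 ?add0r.
  have igA : L1 (fun w => g w * \1_A w + g0 w * \1_(~` A) w).
    rewrite (_ : (fun w => _) = fun w => fine (H yA w) - dot yA w); last first.
      by apply/funext => w; rewrite gE.
    by apply: L1B => //; exact: idot.
  have ig : L1 (fun w => g w * \1_A w).
    rewrite (_ : (fun w => _) = (fun w => (g w * \1_A w + g0 w * \1_(~` A) w) * \1_A w)).
      exact: L1_indic.
    apply/funext => w; rewrite !indicE in_setC.
    by case: (w \in A); rewrite /= ?mulr1 ?mulr0 ?addr0.
  split => //.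
    apply: filterS (integrable_ae measurableT iyA) => w /(_ I).
    by rewrite HE => + Aw; rewrite mem_set.
  have := pc byA; rewrite /Eh (integrable_expectE iyA) lee_fin.
  rewrite -Edot; last by move=> i; exact: L1_mul_bounded.
  rewrite -ED//; last exact: L1_indic.
  have -> : E (fun w => g w * \1_A w + g0 w * \1_(~` A) w) = E (fine \o H yA) - E (dot yA).
    by rewrite -EB//; [apply: E_ext => w; rewrite -gE|exact: idot].
  lra.
(* [r] is [fine] of [H y] and hides infinite values; these are excluded on each [B k], hence almost
   surely. *)
have finHy : {ae P, forall w, H y w \is a fin_num}.
  have : {ae P, forall w, forall k, B k w -> H y w \is a fin_num}.
    by apply/ae_foralln => k; have [] := main k (B k) (mB k) (@subset_refl _ _).
  by apply: filterS => w Hw; have [k Bk] := cB w; exact: Hw Bk.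
pose rp w := Num.max (r w) 0; pose gn w := Num.max (- g w) 0.
have irp : L1 rp.
  apply/integrableP; split.
    by apply/measurable_EFinP; exact: measurable_maxr.
  apply: le_lt_trans Hyp; apply: ge0_le_integral => //.
  - apply: measurableT_comp => //; apply/measurable_EFinP; exact: measurable_maxr.
  - by apply: measurable_funepos; exact: mH.
  - move=> w _; rewrite /rp /r funeposE /=.
    have : 0 <= Num.max (fine (H y w)) 0 by rewrite le_max lexx orbT.
    move=> /ger0_norm ->; case: (H y w) => [s||] /=; rewrite ?EFin_max ?maxxx//.
      by rewrite maxye leey.
    by rewrite le_max lexx orbT.
have ign : L1 gn.
  (* By [main] on the part of [B k] where [g < 0], the integral of [- g] there is at most [c] plus
     that of [g0] off this part. *)
  apply: (@L1_bounded_exhaustion _ _ _ P _ B (c + E (fun w => `|g0 w|))) => //.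
  - by apply: measurable_maxr => //; exact: measurableT_comp.
  - by move=> w; rewrite le_max lexx orbT.
  - move=> k; have [_ ig _] := main k (B k) (mB k) (@subset_refl _ _).
    apply: L1_le (L1_norm ig) _.
      apply: measurable_funM; last exact/measurable_indic/mB.
      by apply: measurable_maxr => //; exact: measurableT_comp.
    move=> w; rewrite !normrM ler_wpM2r// /gn ger0_norm; last by rewrite le_max lexx orbT.
    by rewrite ge_max normr_ge0 -normrN ler_norm.
  - move=> k; pose A := B k `&` [set w | g w < 0].
    have mA : measurable A.
      apply: measurableI; first exact: mB.
      rewrite (_ : [set w | _] = g @^-1` [set` `]-oo, 0[]).
        by rewrite -[X in measurable X]setTI; apply: mg => //; exact: measurable_itv.
      by apply/seteqP; split => w /=; rewrite in_itv.
    have [_ ig cA] := main k A mA (@subIsetl _ _ _).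
    have -> : E (fun w => gn w * \1_(B k) w) = - E (fun w => g w * \1_A w).
      rewrite -mulN1r -EZ//; apply: E_ext => w; rewrite /gn !indicE in_setI mulN1r.
      case: (w \in B k); rewrite /= ?mulr0 ?oppr0// mulr1.
      have [w0|w0] := ltP (g w) 0.
        by rewrite mem_set// mulr1 max_l// oppr_ge0 ltW.
      by rewrite memNset ?mulr0 ?oppr0 ?max_r ?oppr_le0//=; apply/negP; rewrite -leNgt.
    have : E (fun w => g0 w * \1_(~` A) w) <= E (fun w => `|g0 w|).
      apply: E_le; [by apply: L1_indic => //; exact: measurableC|exact: L1_norm|].
      move=> w; rewrite indicE; case: (_ \in _); rewrite ?mulr1 ?mulr0 ?ler_norm//.
    lra.
have ipz' : L1 (dot z) by apply: L1_sum => i; exact: ipz.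
have dotyE w : dot y w = dot x w + dot z w.
  by rewrite /dot -big_split/=; apply: eq_bigr => i _; rewrite yE mulrDr.
(* As [dot x = r - g - dot z], the positive part of [r] and the negative part of [g] provide the
   integrable upper bound required for orthogonality to the unbounded [x]. *)
have [idx Edx] : L1 (dot x) /\ E (dot x) = 0.
  apply: (@orthogonal_unbounded _ _ _ P T m tau F hF p ip op
    (fun i w => x w 0 i) ax (fun w => rp w + gn w + `|dot z w|)).
    by apply: L1D; [exact: L1D|exact: L1_norm].
  move=> w; rewrite -/(dot x w).
  have h1 : r w <= rp w by rewrite le_max lexx.
  have h2 : - g w <= gn w by rewrite le_max lexx.
  have := dotyE w; have := ler_norm (- dot z w); rewrite normrN.
  by move: h2; rewrite /g; lra.
have idy : L1 (dot y).
  rewrite (_ : dot y = fun w => dot x w + dot z w); first exact: L1D.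
  exact/funext.
have Edy : E (dot y) = E (dot z).
  by rewrite (E_ext _ dotyE) ED// Edx add0r.
have ir : L1 r.
  apply: (@L1_le _ _ _ P (fun w => rp w + gn w + `|dot y w|)) => //.
    by apply: L1D; [exact: L1D|exact: L1_norm].
  move=> w; have h1 : r w <= rp w by rewrite le_max lexx.
  have h2 : - g w <= gn w by rewrite le_max lexx.
  have h3 : 0 <= rp w by rewrite le_max lexx orbT.
  have h4 : 0 <= gn w by rewrite le_max lexx orbT.
  have h5 := ler_norm (- dot y w); rewrite normrN in h5.
  have h6 := normr_ge0 (dot y w).
  by rewrite ler_norml; move: h2; rewrite /g => h2; apply/andP; split; lra.
have iHy : P.-integrable setT (H y).
  apply/integrableP; split; first exact: mH.
  have /integrableP[_] := ir; apply: le_lt_trans; rewrite le_eqVlt; apply/orP; left.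
  apply/eqP; apply: ge0_ae_eq_integral => //.
  - by apply: measurableT_comp => //; exact: mH.
  - by apply: measurableT_comp => //; apply/measurable_EFinP.
  - by apply: filterS finHy => w fw _; rewrite -[in LHS](fineK fw).
rewrite /Eh (integrable_expectE iHy) lee_fin -Edot// -Edy.
have ig : L1 g by exact: L1B.
rewrite lerBlDr -lerBlDl -opprB lerNl -[E (fine \o _) - _]EB//.
apply/ler_addgt0Pl => e e0.
have [k ke] := E_compl_small (L1D (L1_norm ig) (L1_norm ig0)) mB ndB cB e0.
have mCB : measurable (~` B k) by apply: measurableC; exact: mB.
have [_ _ ck] := main k (B k) (mB k) (@subset_refl _ _).
apply: (le_trans ck); rewrite -lerBlDr; apply: le_trans ke.
rewrite -ED; [|by apply: L1_indic => //; exact: mB|exact: L1_indic].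
rewrite -EB//; last by apply: L1D; [apply: L1_indic => //; exact: mB|exact: L1_indic].
apply: E_le.
- apply: L1B => //; apply: L1D; [apply: L1_indic => //; exact: mB|exact: L1_indic].
- by apply: L1_indic => //; apply: L1_norm; apply: L1D; exact: L1_norm.
- move=> w; rewrite -/(g w) !indicE in_setC.
  have h1 := ler_norm (- g w); have h2 := ler_norm (g0 w); rewrite normrN in h1.
  rewrite (ger0_norm (addr_ge0 (normr_ge0 (g w)) (normr_ge0 (g0 w)))).
  case: (w \in B k); rewrite /= ?mulr1 ?mulr0 ?addr0 ?add0r; lra.
Qed.

End extension_to_unbounded.

(** * Removal of the singular parts, backwards in time *)

Section eliminating_the_singular_part.
Context {d : measure_display} {Omega : measurableType d} {R : realType}.
Variables (P : probability Omega R) (T m : nat) (tau : 'I_m -> 'I_T.+1).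
Variable F : 'I_T.+1 -> set (set Omega).
Hypothesis hF : filtration F.
Local Notation L1 u := (P.-integrable setT (EFin \o u)).
Local Notation E u := (Rintegral P setT u).
Local Notation ce t := (cond_exp P (F t)).

Lemma bounded_functional_E (q : Omega -> R) : L1 q ->
  bounded_functional P (fun f => E (fun w => q w * f w)).
Proof.
move=> iq; split => [a f g bf bg|].
  have [jf jg] := (L1_mul_bounded iq bf, L1_mul_bounded iq bg).
  rewrite -EZ// -ED//; last exact: L1Z.
  by apply: E_ext => w; ring.
exists (E (fun w => `|q w|)) => M f bf fM.
have [g [mg gM fg]] := ae_bounded_version bf.1 fM.
rewrite (@E_ae _ _ _ P _ (fun w => q w * g w)).
- by rewrite mulrC; exact: E_norm_le_bounded.
- exact: L1_measurable (L1_mul_bounded iq bf).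
- exact: L1_measurable (L1_mul iq mg gM).
- by apply: filterS fg => w ->.
Qed.

Lemma bounded_functionalB_functional (v w : (Omega -> R) -> R) :
  bounded_functional P v -> bounded_functional P w ->
  bounded_functional P (fun f => v f - w f).
Proof.
move=> [vl [C vC]] [wl [K wK]]; split => [a f g bf bg|].
  by rewrite vl// wl//; ring.
exists (C + K) => M f bf fM; rewrite (le_trans (ler_normB _ _))// mulrDl lerD//.
  exact: vC.
exact: wK.
Qed.

Lemma bounded_functional_cond_exp t (v : (Omega -> R) -> R) :
  bounded_functional P v -> bounded_functional P (fun f => v (ce t f)).
Proof.
have [sF FM _] := hF => bv; have [vl [C vC]] := bv.
have bce f : bounded_measurable f -> bounded_measurable (ce t f).
  exact: (cond_exp_bounded_measurable P (sF t) (FM t)).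
split => [a f g bf bg|].
  rewrite -vl; [|exact: bce..]; apply: (bounded_functional_ae bv).
  - by apply: bce; exact: bounded_measurable_lin.
  - by apply: bounded_measurable_lin; exact: bce.
  - exact: cond_exp_lin.
exists C => M f bf fM; apply: vC; first exact: bce.
exact: cond_exp_norm_le.
Qed.

(** The exceptional sets of the coordinates are merged by union, which is harmless for properties
    inherited by larger sets. *)
Lemma small_set_common (Q : 'I_m -> set Omega -> Prop) :
  (forall i A B, A `<=` B -> Q i A -> Q i B) ->
  (forall i (e : R), 0 < e -> exists A, [/\ measurable A, (P A < e%:E)%E & Q i A]) ->
  forall e : R, 0 < e -> exists A, [/\ measurable A, (P A < e%:E)%E & forall i, Q i A].
Proof.
move=> Qm QP e e0.
suff H (s : seq 'I_m) : forall e : R, 0 < e ->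
    exists A, [/\ measurable A, (P A < e%:E)%E & forall i, i \in s -> Q i A].
  have [A [mA PA QA]] := H (enum 'I_m) e e0; exists A; split => // i.
  by apply: QA; rewrite mem_enum.
elim: s => [|i s IH] {}e {}e0.
  by exists set0; split => //; rewrite measure0 lte_fin.
have e20 : 0 < e / 2 by rewrite divr_gt0.
have [A [mA PA QA]] := IH _ e20; have [B [mB PB QB]] := QP i _ e20.
exists (A `|` B); split; first exact: measurableU.
  rewrite (le_lt_trans (measureU2 _ _ _))//.
  by rewrite [X in (_ < X%:E)%E](splitr e) EFinD lteD.
move=> j; rewrite inE => /predU1P[->|js]; first by apply: Qm QB => w; right.
by apply: Qm (QA j js) => w; left.
Qed.

Variable h : 'rV[R]_m -> Omega -> \bar R.
Hypothesis hN : normal_integrand h.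
Hypothesis Eh_gtNy : forall z, bounded_row z -> Eh P h z != -oo%E.
Hypothesis hce : forall z, bounded_row z -> (Eh P h z < +oo)%E -> forall t : 'I_T.+1,
  exists zhat, [/\ bounded_row zhat, (Eh P h zhat < +oo)%E &
    forall i, (tau i <= t)%N ->
      {ae P, forall w, ce t (fun w => z w 0 i) w = zhat w 0 i}].
Variable c : R.

(* Rockafellar's splitting: away from sets of small probability the singular parts
   [v i - E (q i * _)] vanish, so they can be evaluated at a different point. *)
Lemma split_singular (p q : 'I_m -> Omega -> R) (v : 'I_m -> (Omega -> R) -> R) :
  (forall i, L1 (p i)) -> (forall i, L1 (q i)) ->
  (forall i, bounded_functional P (v i)) ->
  (forall i (e : R), 0 < e -> exists A, [/\ measurable A, (P A < e%:E)%E &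
    forall f, bounded_measurable f -> (forall w, A w -> f w = 0) ->
      v i f = E (fun w => q i w * f w)]) ->
  (forall z, bounded_row z ->
    ((\sum_i (E (fun w => p i w * z w 0 i) + v i (fun w => z w 0 i)) - c)%:E <=
       Eh P h z)%E) ->
  forall z z', bounded_row z -> bounded_row z' ->
    (Eh P h z < +oo)%E -> (Eh P h z' < +oo)%E ->
    ((\sum_i (E (fun w => (p i w + q i w) * z w 0 i) +
      (v i (fun w => z' w 0 i) - E (fun w => q i w * z' w 0 i))) - c)%:E <= Eh P h z)%E.
Proof.
move=> ip iq bv vq pv z z' bz bz' Ez Ez'.
pose H (z : Omega -> 'rV[R]_m) w := h (z w) w.
have iH := Eh_lty_integrable hN Eh_gtNy bz Ez.
have iH' := Eh_lty_integrable hN Eh_gtNy bz' Ez'.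
have [ir ir'] := (fine_L1 iH, fine_L1 iH').
pose pq i w := p i w + q i w.
have ipq i : L1 (pq i) by exact: L1D.
pose dot (z : Omega -> 'rV[R]_m) w : R := \sum_i pq i w * z w 0 i.
have idot (u : Omega -> 'rV[R]_m) : bounded_row u -> L1 (dot u).
  by move=> bu; apply: L1_sum => i; exact: L1_mul_bounded.
have Edot (u : Omega -> 'rV[R]_m) : bounded_row u ->
    E (dot u) = \sum_i E (fun w => pq i w * u w 0 i).
  by move=> bu; rewrite E_sum// => i; exact: L1_mul_bounded.
pose s i f := v i f - E (fun w => q i w * f w).
have bs i : bounded_functional P (s i).
  by apply: bounded_functionalB_functional => //; exact: bounded_functional_E.
rewrite /Eh (integrable_expectE iH) lee_fin big_split/= -(Edot z bz).
apply/ler_addgt0Pl => e e0.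
(* [U] dominates the change of the linear form minus the integrand when [z] is replaced by [z'], so
   its integral over [A] bounds the cost of the gluing. *)
pose U w := `|fine (H z w)| + `|fine (H z' w)| + (`|dot z w| + `|dot z' w|).
have iU : L1 U.
  apply: L1D; first by apply: L1D; exact: L1_norm.
  by apply: L1D; apply: L1_norm; exact: idot.
have [r r0 rP] := E_absolutely_continuous iU e0.
have [A [mA PA vA]] := @small_set_common (fun i A => forall f, bounded_measurable f ->
    (forall w, A w -> f w = 0) -> v i f = E (fun w => q i w * f w))
  (fun i A B AB QA f bf f0 => QA f bf (fun w Aw => f0 w (AB w Aw))) vq r r0.
have [M zM] : exists M : R, forall w i, ~ A w -> `|z w 0 i| <= M.
  have /choice[K zK] : forall i, exists K : R, forall w, `|z w 0 i| <= K.
    by move=> i; have [_] := bz i.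
  exists (\sum_i `|K i|) => w i _; rewrite (le_trans (zK i w))//.
  by rewrite (bigD1 i)//= (le_trans (ler_norm _))// lerDl sumr_ge0.
pose y := glue A z z'.
have by_ : bounded_row y.
  by apply: bounded_row_glue zM bz' => //; exact: bounded_row_measurable.
have HE w : H y w = if w \in A then H z' w else H z w by rewrite /H integrand_glue.
have iHy : P.-integrable setT (H y).
  have mHy : measurable_fun setT (H y).
    by apply: normal_integrand_measurable => //; exact: bounded_row_measurable.
  apply: (@le_integrable _ _ _ P setT measurableT _ (fun w => `|H z w| + `|H z' w|)%E) => //.
    move=> w _; rewrite HE [leRHS]gee0_abs ?adde_ge0//.
    by case: ifP => _; [apply: leeDr|apply: leeDl].
  by apply: (integrableD measurableT); exact: integrable_abse.
have iry := fine_L1 iHy.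
(* [y] and [z'] agree on [A], and [s i] vanishes on bounded functions that are zero there. *)
have sE i : s i (fun w => y w 0 i) = s i (fun w => z' w 0 i).
  apply/eqP; rewrite -subr_eq0 -(bounded_functionalB (bs i)) ?by_ ?bz'//.
  rewrite /s vA ?subrr//.
    have := bounded_measurable_lin (-1) (bz' i) (by_ i); congr bounded_measurable.
    by apply/funext => w; rewrite mulN1r addrC.
  by move=> w Aw; rewrite /y /glue mem_set// subrr.
have := pv y by_; rewrite /Eh (integrable_expectE iHy) lee_fin.
have -> : \sum_i (E (fun w => p i w * y w 0 i) + v i (fun w => y w 0 i)) =
    E (dot y) + \sum_i s i (fun w => z' w 0 i).
  rewrite Edot// -big_split/=; apply: eq_bigr => i _; rewrite -sE /s.
  have -> : E (fun w => pq i w * y w 0 i) =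
      E (fun w => p i w * y w 0 i) + E (fun w => q i w * y w 0 i).
    rewrite -ED; [|exact: L1_mul_bounded..].
    by apply: E_ext => w; rewrite /pq mulrDl.
  ring.
have UA : E (fun w => (dot z w - fine (H z w)) - (dot y w - fine (H y w))) <= e.
  apply: (le_trans _ (rP A mA PA)); apply: E_le.
  - by apply: L1B; apply: L1B => //; exact: idot.
  - by apply: L1_indic => //; exact: L1_norm.
  - move=> w; rewrite indicE HE /dot /y /glue.
    case: (w \in A); last by rewrite subrr mulr0.
    rewrite mulr1 -/(dot z w) -/(dot z' w) ger0_norm; last by rewrite /U !addr_ge0.
    rewrite /U; have := ler_norm (dot z w); have := ler_norm (- dot z' w).
    have := ler_norm (- fine (H z w)); have := ler_norm (fine (H z' w)).
    rewrite !normrN; lra.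
move: UA; rewrite EB; [|by apply: L1B => //; exact: idot..].
rewrite !EB//; [|exact: idot..].
rewrite -/(s _ _) /= => UA; rewrite -/(H y) -/(H z) in UA *.
by rewrite /s in UA *; move: UA; lra.
Qed.

(** Orthogonality and the minorant are carried through the induction together: orthogonality of
    [p i] plus [v i] converts the time-[t] singular part into a density, and the minorant is
    re-established by evaluating the singular parts at [zhat]. *)
Lemma eliminate_singular_part (nu : 'I_m -> (Omega -> R) -> R) :
  (forall i, bounded_functional P (nu i)) ->
  (forall i (y : Omega -> R), measurable_wrt (F (tau i)) y ->
     (exists M : R, forall w, `|y w| <= M) -> nu i y = 0) ->
  (forall z, bounded_row z -> ((\sum_i nu i (fun w => z w 0 i) - c)%:E <= Eh P h z)%E) ->
  exists p : 'I_m -> Omega -> R,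
    [/\ forall i, L1 (p i), orthogonal_to_adapted P tau F p &
        forall z, bounded_row z ->
          ((\sum_i E (fun w => p i w * z w 0 i) - c)%:E <= Eh P h z)%E].
Proof.
have [sF FM Fnd] := hF => bv0 ov0 vc0.
(* In [claim k] the functionals [v i] may be nonzero only at times before [k]; the descent starts at
   [k = T + 1] with [p = 0] and ends at [k = 0] with densities only. *)
pose claim k := exists (p : 'I_m -> Omega -> R) (v : 'I_m -> (Omega -> R) -> R),
  [/\ forall i, L1 (p i), forall i, bounded_functional P (v i),
      forall i, (k <= tau i)%N -> forall f, bounded_measurable f -> v i f = 0,
      forall i (y : Omega -> R), measurable_wrt (F (tau i)) y ->
        (exists M : R, forall w, `|y w| <= M) -> E (fun w => p i w * y w) + v i y = 0 &
      forall z, bounded_row z ->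
        ((\sum_i (E (fun w => p i w * z w 0 i) + v i (fun w => z w 0 i)) - c)%:E <=
           Eh P h z)%E].
have i0 : L1 (fun=> 0) by apply/bounded_measurable_L1/bounded_measurable_cst.
have E0 (f : Omega -> R) : E (fun w => 0 * f w) = 0.
  by rewrite -[RHS](@E_cst _ _ _ P); apply: E_ext => w; rewrite mul0r.
suff [p [v [ip bv v0 ov pv]]] : claim 0%N.
  exists p; split => //.
  - move=> i y my yM; have := ov i y my yM; rewrite v0 ?addr0//.
    by split => //; exact: (measurable_wrt_measurable (FM _) my).
  - move=> z bz; have := pv z bz.
    rewrite (eq_bigr (fun i => E (fun w => p i w * z w 0 i)))// => i _.
    by rewrite v0 ?addr0.
suff step t : claim (nat_of_ord t).+1 -> claim (nat_of_ord (t : 'I_T.+1)).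
  have base : claim T.+1.
    exists (fun _ _ => 0), nu; split => //.
    - by move=> i; rewrite leqNgt ltn_ord.
    - by move=> i y my yM; rewrite E0 add0r; exact: ov0.
    - move=> z bz; rewrite (eq_bigr (fun i => nu i (fun w => z w 0 i))); first exact: vc0.
      by move=> i _; rewrite E0 add0r.
  have : forall k, (k <= T.+1)%N -> claim (T.+1 - k)%N.
    elim=> [_|k IH kT]; first by rewrite subn0.
    have lt : (T.+1 - k.+1 < T.+1)%N by rewrite subSS ltnS leq_subr.
    apply: (step (Ordinal lt)) => /=; rewrite subSS -subSn//.
    by apply: IH; exact: ltnW.
  by move=> /(_ T.+1 (leqnn _)); rewrite subnn.
move=> [p [v [ip bv v0 ov pv]]].
have bce f : bounded_measurable f -> bounded_measurable (ce t f).
  exact: (cond_exp_bounded_measurable P (sF t) (FM t)).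
(* For times after [t], where [v i] is zero already, the density is chosen to be [0] itself so that
   [p i] is left untouched. *)
have /choice[q qP] : forall i, exists q : Omega -> R, [/\ L1 q, ((t < tau i)%N -> q = fun=> 0) &
    forall e : R, 0 < e -> exists A, [/\ measurable A, (P A < e%:E)%E &
    forall f, bounded_measurable f -> (forall w, A w -> f w = 0) ->
      v i f = E (fun w => q w * f w)]].
  move=> i; have [ti|ti] := ltnP t (tau i).
    exists (fun=> 0); split => // e e0; exists set0; split => //.
      by rewrite measure0 lte_fin.
    by move=> f bf _; rewrite v0// E0.
  have [q iq qP] := yosida_hewitt (bv i); by exists q.
have iq i : L1 (q i) by have [] := qP i.
pose pq i w := p i w + q i w.
have ipq i : L1 (pq i) by exact: L1D.
have EpqE i f : bounded_measurable f ->
    E (fun w => pq i w * f w) = E (fun w => p i w * f w) + E (fun w => q i w * f w).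
  move=> bf; rewrite -ED; [|exact: L1_mul_bounded..].
  by apply: E_ext => w; rewrite /pq mulrDl.
pose s i f := v i f - E (fun w => q i w * f w).
have bs i : bounded_functional P (s i).
  by apply: bounded_functionalB_functional => //; exact: bounded_functional_E.
have /choice[g gP] := fun i => cond_exp_L1 (sF t) (FM t) (ipq i).
have ig i : L1 (g i) by have [] := gP i.
have s0 i f : (t < tau i)%N -> bounded_measurable f -> s i f = 0.
  by move=> ti bf; have [_ /(_ ti) q0 _] := qP i; rewrite /s v0// q0 E0 subrr.
exists (fun i w => pq i w - (if tau i == t then g i w else 0)).
exists (fun i f => if (tau i < t)%N then s i (ce t f) else 0).
have EpE i f : bounded_measurable f ->
    E (fun w => (pq i w - (if tau i == t then g i w else 0)) * f w) =
    E (fun w => pq i w * f w) - (if tau i == t then E (fun w => g i w * f w) else 0).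
  move=> bf; case: (tau i == t).
    rewrite -EB; [|exact: L1_mul_bounded..].
    by apply: E_ext => w; rewrite mulrBl.
  by rewrite subr0; apply: E_ext => w; rewrite subr0.
split.
- by move=> i; case: (tau i == t); apply: L1B.
- move=> i; case: (tau i < t)%N; first exact: bounded_functional_cond_exp.
  split => [a f f' _ _|]; first by rewrite mulr0 addr0.
  by exists 0 => M f _ _; rewrite normr0 mul0r.
- by move=> i ti f _; rewrite ltnNge ti.
- move=> i y my yM; have by_ : bounded_measurable y.
    by split => //; exact: (measurable_wrt_measurable (FM _) my).
  rewrite EpE//; case: (ltngtP (tau i) t) => ti.
  + have -> : (tau i == t) = false by apply/negbTE; rewrite neq_ltn ti.
    (* A test function known at the earlier time [tau i] is fixed by [ce t], so the composition
       keeps the orthogonality. *)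
    have -> : s i (ce t y) = s i y.
      apply: (bounded_functional_ae (bs i)); [exact: bce|by []|].
      by apply: cond_exp_id => //; apply: (measurable_wrt_le hF) my; exact: ltnW.
    by rewrite subr0 EpqE// /s; have := ov i y my yM; lra.
  + have -> : (tau i == t) = false by apply/negbTE; rewrite neq_ltn ti orbT.
    have := ov i y my yM; rewrite v0// subr0 !addr0 EpqE// => ->.
    by have [_ /(_ ti) -> _] := qP i; rewrite E0 addr0.
  + have et : tau i = t by exact: val_inj.
    rewrite et eqxx addr0; have [mg _ gA] := gP i.
    apply/eqP; rewrite subr_eq0; apply/eqP.
    apply: (E_mul_eq_on_bounded (sF t) (FM t)) => //; last by rewrite -et.
    by move=> A FA; rewrite gA.
- move=> z bz; have [Ez|] := boolP (Eh P h z < +oo)%E; last first.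
    by rewrite -leNgt leye_eq => /eqP ->; rewrite leey.
  have [zh [bzh Ezh zhP]] := hce bz Ez t.
  have := split_singular ip iq bv (fun i => (let: And3 _ _ H := qP i in H)) pv bz bzh Ez Ezh.
  apply: le_trans; rewrite lee_fin lerD2r; apply: ler_sum => i _.
  rewrite EpE; last exact: bz.
  rewrite -/(pq i _) -/(s i _).
  have sce : (tau i <= t)%N -> s i (fun w => zh w 0 i) = s i (ce t (fun w => z w 0 i)).
    move=> ti; apply/esym/(bounded_functional_ae (bs i)); [exact: bce|exact: bzh|exact: zhP].
  case: (ltngtP (tau i) t) => ti.
  + have -> : (tau i == t) = false by apply/negbTE; rewrite neq_ltn ti.
    by rewrite subr0 -sce// ltnW.
  + have -> : (tau i == t) = false by apply/negbTE; rewrite neq_ltn ti orbT.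
    by rewrite subr0 s0.
  (* Orthogonality at [ce t z] gives [s i (ce t z) = - E (pq i * ce t z)], which equals
     [- E (g i * z)] by self-adjointness. *)
  + have et : tau i = t by exact: val_inj.
    rewrite et eqxx addr0 sce ?ti//; have [mg _ gA] := gP i.
    have [mc bc _] := cond_expP P (sF t) (FM t) (bz i).
    rewrite -(cond_exp_selfadjoint (sF t) (FM t) (ipq i) mg (ig i) gA (bz i)).
    have := ov i (ce t (fun w => z w 0 i)); rewrite et => /(_ mc bc).
    rewrite (EpqE i _ (bce _ (bz i))) /s.
    rewrite -[E (fun w => (p i w + q i w) * _)]/(E (fun w => pq i w * z w 0 i)).
    lra.
Qed.

End eliminating_the_singular_part.

(** * Vector-valued L^1 and L^infty, their pairing and the strong dual, in coordinates *)

Section row_spaces.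
Context {d : measure_display} {Omega : measurableType d} {R : realType} {m : nat}.
Variable P : probability Omega R.
Implicit Types (x y z p : Omega -> 'rV[R]_m).
Local Notation L1 u := (P.-integrable setT (EFin \o u)).
Local Notation E u := (Rintegral P setT u).

Lemma row_norm_le (a : 'rV[R]_m) (M : R) : 0 <= M ->
  (forall i, `|a 0 i| <= M) -> `|a| <= M.
Proof.
move=> M0 aM; rewrite -[`|a|]/(mx_norm a) mx_normrE; apply: bigmax_le => // -[i j] _ /=.
by rewrite (ord1 i).
Qed.

Lemma row_norm_ge (a : 'rV[R]_m) i : `|a 0 i| <= `|a|.
Proof.
rewrite -[leRHS]/(mx_norm a) mx_normrE.
exact: (le_bigmax _ (fun ij => `|a ij.1 ij.2|) (0, i)).
Qed.

Lemma measurable_row_norm x : measurable_row x -> measurable_fun setT (fun w => `|x w|).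
Proof.
move=> mx.
have -> : (fun w => `|x w|) = (fun w => \big[Num.max/0]_(ij : 'I_1 * 'I_m) `|x w ij.1 ij.2|).
  by apply/funext => w; rewrite -mx_normrE.
elim: (index_enum _) => [|[i j] s IH].
  by rewrite (_ : (fun w => _) = cst 0)//; apply/funext => w; rewrite big_nil.
rewrite (_ : (fun w => _) = fun w => Num.max `|x w i j|
    (\big[Num.max/0]_(ij <- s) `|x w ij.1 ij.2|)).
  apply: measurable_maxr => //; apply: measurableT_comp => //.
  by rewrite (ord1 i); exact: mx.
by apply/funext => w; rewrite big_cons.
Qed.

Lemma L0_measurable_row x : L0 measurable x <-> measurable_row x.
Proof.
split=> [mx i _ B mB|mx i B mB]; first by rewrite setTI; exact: mx.
by rewrite -[X in measurable X]setTI; exact: mx.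
Qed.

Lemma LpNorm_inf_le x (M : R) : 0 <= M ->
  {ae P, forall w, forall i, `|x w 0 i| <= M} -> (LpNorm P +oo x <= M%:E)%E.
Proof.
move=> M0 xM; rewrite /LpNorm unlock /= (@probability_setT _ _ _ P) lte01.
apply/ess_supP; apply: filterS xM => w xM /=.
by rewrite normr_id lee_fin row_norm_le.
Qed.

Lemma LinfP x : Lp P +oo%E x <-> measurable_row x /\
  exists M : R, {ae P, forall w, forall i, `|x w 0 i| <= M}.
Proof.
split=> [[/L0_measurable_row mx]|[mx [M xM]]].
  rewrite /LpNorm unlock /= (@probability_setT _ _ _ P) lte01 => xy; split => //.
  have := ess_sup_ge P (abse \o (fun w => `|x w|%:E)%E).
  set S := ess_sup _ _ in xy *.
  move=> xS; exists (fine S); apply: filterS xS => w /= xS i.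
  rewrite (le_trans (row_norm_ge _ i))//.
  by move: xy xS; case: S => //= r _; rewrite normr_id.
split; first exact/L0_measurable_row.
apply: (@le_lt_trans _ _ `|M|%:E); last exact: ltry.
apply: LpNorm_inf_le => //; apply: filterS xM => w xM i.
exact: le_trans (xM i) (ler_norm _).
Qed.

Lemma bounded_row_Linf x : bounded_row x -> Lp P +oo%E x.
Proof.
move=> bx; apply/LinfP; split; first exact: bounded_row_measurable.
have /choice[K xK] : forall i, exists K : R, forall w, `|x w 0 i| <= K.
  by move=> i; have [_] := bx i.
exists (\sum_i `|K i|); apply/aeW => w i; rewrite (le_trans (xK i w))//.
by rewrite (bigD1 i)//= (le_trans (ler_norm _))// lerDl sumr_ge0.
Qed.

Lemma ae_forall_ord (Q : 'I_m -> Omega -> Prop) :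
  (forall i, {ae P, forall w, Q i w}) -> {ae P, forall w, forall i, Q i w}.
Proof.
move=> H; have : {ae P, forall w, forall k (lt : (k < m)%N), Q (Ordinal lt) w}.
  apply/ae_foralln => k; have [lt|nlt] := pselect (k < m)%N; last by apply/aeW => w lt; case: nlt.
  apply: filterS (H (Ordinal lt)) => w Qw lt'.
  by rewrite (_ : Ordinal lt' = Ordinal lt)//; exact: val_inj.
by apply: filterS => w Qw [k lt]; exact: Qw.
Qed.

Lemma Linf_bounded_version x : Lp P +oo%E x ->
  exists2 y, bounded_row y & {ae P, forall w, x w = y w}.
Proof.
move=> /LinfP[mx [M xM]].
have /choice[f fP] : forall i, exists f : Omega -> R, [/\ measurable_fun setT f,
    forall w, `|f w| <= M & {ae P, forall w, x w 0 i = f w}].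
  by move=> i; apply: ae_bounded_version => //; apply: filterS xM => w.
exists (fun w => \row_i f i w).
  move=> i; have [mf fM _] := fP i; rewrite (_ : (fun w => _) = f i).
    by split => //; exists M.
  by apply/funext => w; rewrite mxE.
have : {ae P, forall w, forall i, x w 0 i = f i w}.
  by apply: ae_forall_ord => i; have [] := fP i.
by apply: filterS => w xf; apply/rowP => i; rewrite mxE.
Qed.

Lemma L1_rowP p : Lp P 1%E p <-> forall i, L1 (fun w => p w 0 i).
Proof.
split=> [[/L0_measurable_row mp]|ip].
  rewrite /LpNorm Lnorm1 => pf i.
  have iN : L1 (fun w => `|p w|).
    apply/integrableP; split; last by [].
    by apply/measurable_EFinP; exact: measurable_row_norm.
  by apply: (L1_le _ iN) => // w; exact: row_norm_ge.
have mp : measurable_row p by move=> i; exact: L1_measurable (ip i).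
split; first exact/L0_measurable_row.
rewrite /LpNorm Lnorm1.
suff /integrableP[_] : L1 (fun w => `|p w|) by [].
apply: (@L1_le _ _ _ P (fun w => \sum_i `|p w 0 i|)).
- exact: measurable_row_norm.
- by apply: L1_sum => i; exact: L1_norm.
- move=> w; rewrite normr_id; apply: row_norm_le; first exact: sumr_ge0.
  by move=> i; rewrite (bigD1 i)//= lerDl sumr_ge0.
Qed.

Lemma Linf_lin (a : R) x y : Lp P +oo%E x -> Lp P +oo%E y -> Lp P +oo%E (a *: x + y).
Proof.
move=> /LinfP[mx [M xM]] /LinfP[my [K yK]]; apply/LinfP; split.
  move=> i; rewrite (_ : (fun w => _) = fun w => a * x w 0 i + y w 0 i).
    by apply: measurable_funD => //; exact: measurable_funM.
  by apply/funext => w; rewrite !mxE.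
exists (`|a| * M + K); apply: filterS2 xM yK => w xM yK i; rewrite !mxE.
by rewrite (le_trans (ler_normD _ _))// lerD// normrM ler_wpM2l.
Qed.

Lemma Linf0 : Lp P +oo%E (0 : Omega -> 'rV[R]_m).
Proof.
apply: bounded_row_Linf => i; rewrite (_ : (fun w => _) = fun=> 0).
  exact: bounded_measurable_cst.
by apply/funext => w; rewrite !mxE.
Qed.

Lemma L1_mul_Linf p z i : (forall i, L1 (fun w => p w 0 i)) -> Lp P +oo%E z ->
  L1 (fun w => p w 0 i * z w 0 i).
Proof.
move=> ip zi; have [y by_ zy] := Linf_bounded_version zi.
have /LinfP[mz _] := zi.
apply: (L1_ae _ (L1_mul_bounded (ip i) (by_ i))).
  by apply: measurable_funM => //; exact: L1_measurable (ip i).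
by apply: filterS zy => w ->.
Qed.

Lemma pairingE p z : (forall i, L1 (fun w => p w 0 i)) -> Lp P +oo%E z ->
  pairing P z p = \sum_i E (fun w => p w 0 i * z w 0 i).
Proof.
move=> ip zi; rewrite /pairing -E_sum; last by move=> i; exact: L1_mul_Linf.
by apply: E_ext => w; apply: eq_bigr => i _; rewrite mulrC.
Qed.

Lemma pairing0 p : pairing P 0 p = 0.
Proof.
rewrite /pairing -[RHS](@E_cst _ _ _ P); apply: E_ext => w.
by apply: big1 => i _; rewrite mxE mul0r.
Qed.

(** [f] times the [i]-th unit vector, the boolean serving as a multiplicity. *)
Definition coord_row i (f : Omega -> R) : Omega -> 'rV[R]_m :=
  fun w => \row_j (f w *+ (i == j)).

Lemma bounded_coord_row i f : bounded_measurable f -> bounded_row (coord_row i f).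
Proof.
move=> bf j; case: (eqVneq i j) => ij.
  rewrite (_ : (fun w => _) = f)//.
  by apply/funext => w; rewrite mxE ij eqxx.
rewrite (_ : (fun w => _) = fun=> 0); first exact: bounded_measurable_cst.
by apply/funext => w; rewrite mxE (negbTE ij).
Qed.

Lemma pairing_coord_row p i f : (forall i, L1 (fun w => p w 0 i)) ->
  bounded_measurable f -> pairing P (coord_row i f) p = E (fun w => p w 0 i * f w).
Proof.
move=> ip bf; have Lf := bounded_row_Linf (bounded_coord_row i bf).
rewrite pairingE// (bigD1 i)//= big1 ?addr0.
  by apply: E_ext => w; rewrite mxE eqxx.
move=> j ji; rewrite -[RHS](@E_cst _ _ _ P); apply: E_ext => w.
by rewrite mxE eq_sym (negbTE ji) mulr0.
Qed.

Lemma Linf_dual0 v : Linf_dual P v -> v (0 : Omega -> 'rV[R]_m) = 0.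
Proof.
move=> [vl _]; have := vl (-1) 0 0 Linf0 Linf0.
by rewrite scaler0 addr0 mulN1r addNr.
Qed.

Lemma Linf_dual_coord v i : Linf_dual P v ->
  bounded_functional P (fun f => v (coord_row i f)).
Proof.
move=> [vl [C vC]]; split => [a f g bf bg|].
  rewrite -vl; [|by apply: bounded_row_Linf; exact: bounded_coord_row..].
  congr v; apply/funext => w; apply/rowP => j; rewrite !mxE.
  by case: (i == j); rewrite ?mulr1n// !mulr0n mulr0 addr0.
(* The bound [C] of a dual element carries no sign condition, hence the absolute value. *)
exists `|C| => M f bf fM; have [f' [mf' f'M ff']] := ae_bounded_version bf.1 fM.
have M0 : 0 <= M by exact: le_trans (normr_ge0 _) (f'M point).
have := vC _ (bounded_row_Linf (bounded_coord_row i bf)).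
move=> /le_trans H; rewrite -lee_fin; apply: H.
apply: (@le_trans _ _ (`|C|%:E * LpNorm P +oo (coord_row i f))%E).
  apply: lee_wpmul2r; first exact: Lnorm_ge0.
  by rewrite lee_fin ler_norm.
rewrite EFinM; apply: lee_wpmul2l => //.
apply: LpNorm_inf_le => //; apply: filterS fM => w fM j; rewrite mxE.
by case: (i == j); rewrite ?mulr1n// mulr0n normr0.
Qed.

Lemma Linf_dual_sum v z : Linf_dual P v -> bounded_row z ->
  v z = \sum_i v (coord_row i (fun w => z w 0 i)).
Proof.
move=> dv bz; have [vl _] := dv.
pose S (s : seq 'I_m) : Omega -> 'rV[R]_m := fun w => \sum_(i <- s) coord_row i (fun w => z w 0 i) w.
(* Linearity of [v] is available inside L^infty only, so membership of the partial sums is carried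
   along. *)
have SL s : Lp P +oo%E (S s) /\ v (S s) = \sum_(i <- s) v (coord_row i (fun w => z w 0 i)).
  elim: s => [|i s [IH1 IH2]].
    rewrite (_ : S [::] = 0); first by rewrite big_nil Linf_dual0//; split => //; exact: Linf0.
    by apply/funext => w; rewrite /S big_nil.
  have bi := bounded_row_Linf (bounded_coord_row i (bz i)).
  rewrite (_ : S (i :: s) = 1 *: coord_row i (fun w => z w 0 i) + S s).
    by split; [exact: Linf_lin|rewrite vl// mul1r IH2 big_cons].
  by apply/funext => w; rewrite /S big_cons scale1r.
have [_ <-] := SL (index_enum _); congr v; apply/funext => w; apply/rowP => j.
rewrite /S summxE (bigD1 j)//= mxE eqxx mulr1n big1 ?addr0// => i ij.
by rewrite mxE (negbTE ij).
Qed.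

Lemma Eh_ae (h : 'rV[R]_m -> Omega -> \bar R) x y : normal_integrand h ->
  measurable_row x -> measurable_row y -> {ae P, forall w, x w = y w} ->
  Eh P h x = Eh P h y.
Proof.
move=> hN mx my xy; rewrite /Eh /expect.
have [mhx mhy] := (normal_integrand_measurable hN mx, normal_integrand_measurable hN my).
have -> : (\int[P]_w ((fun w => h (x w) w)^\+ w) = \int[P]_w ((fun w => h (y w) w)^\+ w))%E.
  apply: ae_eq_integral => //; [exact: measurable_funepos..|].
  by apply: filterS xy => w xw _; rewrite !funeposE xw.
have -> // : (\int[P]_w h (x w) w = \int[P]_w h (y w) w)%E.
apply: ae_eq_integral => //.
by apply: filterS xy => w xw _; rewrite xw.
Qed.

End row_spaces.

(** * Adapted processes and conditional expectations in flattened coordinates *)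

Section adapted_rows.
Context {d : measure_display} {Omega : measurableType d} {R : realType}.
Variables (P : probability Omega R) (T : nat) (n : 'I_T.+1 -> nat).
Variable F : 'I_T.+1 -> set (set Omega).
Hypothesis hF : filtration F.
Local Notation N := (\sum_(t < T.+1) n t)%N.
Local Notation tau := (@tagnat.sig1 T.+1 n).
Implicit Types (x y z : Omega -> 'rV[R]_N).
Local Notation L1 u := (P.-integrable setT (EFin \o u)).
Local Notation E u := (Rintegral P setT u).

Lemma blockE x t w j : block x t w 0 j = x w 0 (tagnat.Rank t j).
Proof. by rewrite /block /submxrow mxE. Qed.

(** Coordinate [i] of the whole vector is coordinate [sig2 i] of the block at time [sig1 i], which
    makes adaptedness a coordinatewise condition with [tau = sig1]. *)
Lemma adaptedP x : adapted F x <->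
  forall i, measurable_wrt (F (tau i)) (fun w => x w 0 i).
Proof.
split=> [ax i B mB|ax t j B mB].
  have := ax (tau i) (tagnat.sig2 i) B mB; congr (F _ _); apply/seteqP.
  by split => w /=; rewrite blockE tagnat.sig2K.
have := ax (tagnat.Rank t j) B mB; rewrite tagnat.Rank1K; congr (F _ _).
by apply/seteqP; split => w /=; rewrite blockE.
Qed.

Lemma adapted_lin (a : R) x y : adapted F x -> adapted F y -> adapted F (a *: x + y).
Proof.
have [sF _ _] := hF => /adaptedP ax /adaptedP ay; apply/adaptedP => i.
rewrite (_ : (fun w => _) = fun w => a * x w 0 i + y w 0 i); last first.
  by apply/funext => w; rewrite !mxE.
apply: measurable_wrtD => //; apply: measurable_wrtM => //.
exact: measurable_wrt_cst.
Qed.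

Lemma adapted0 : adapted F (0 : Omega -> 'rV[R]_N).
Proof.
have [sF _ _] := hF; apply/adaptedP => i; rewrite (_ : (fun w => _) = fun=> 0).
  exact: measurable_wrt_cst.
by apply/funext => w; rewrite !mxE.
Qed.

Lemma adapted_coord_row i (f : Omega -> R) : measurable_wrt (F (tau i)) f ->
  adapted F (coord_row i f).
Proof.
have [sF _ _] := hF => mf; apply/adaptedP => j; case: (eqVneq i j) => ij.
  rewrite -ij (_ : (fun w => _) = f)//.
  by apply/funext => w; rewrite mxE eqxx.
rewrite (_ : (fun w => _) = fun=> 0); first exact: measurable_wrt_cst.
by apply/funext => w; rewrite mxE (negbTE ij).
Qed.

(** [condexp_eq] speaks of some version and [cond_exp] of a chosen one; almost sure uniqueness
    identifies them. *)
Lemma condexp_eq_cond_exp z zhat t i : bounded_row z ->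
  condexp_eq P (F t) (block z (tau i)) (block zhat (tau i)) ->
  {ae P, forall w, cond_exp P (F t) (fun w => z w 0 i) w = zhat w 0 i}.
Proof.
have [sF FM _] := hF => bz [y [my /L1_rowP iy yz zy]].
have H : {ae P, forall w, cond_exp P (F t) (fun w => z w 0 i) w = y w 0 (tagnat.sig2 i)}.
  apply: cond_exp_unique; [exact: sF|exact: FM|exact: bz| |exact: iy|].
    by move=> B mB; exact: my.
  move=> A FA; have mA := FM _ _ FA.
  have := yz A (tagnat.sig2 i) FA; rewrite (integral_in_L1 mA (iy _)).
  have -> : (\int[P]_(w in A) (block z (tau i) w 0 (tagnat.sig2 i))%:E =
      \int[P]_(w in A) (z w 0 i)%:E)%E.
    by apply: eq_integral => w _; rewrite blockE tagnat.sig2K.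
  by rewrite (integral_in_L1 mA (bounded_measurable_L1 P (bz i))) => -[].
apply: filterS2 H zy => w -> zyw.
by rewrite -zyw blockE tagnat.sig2K.
Qed.

End adapted_rows.

(** * Elementary properties of biconjugates *)

Section biconjugates.
Context {R : realType} {X : zmodType} {Y : Type}.
Variables (D : set X) (V : set Y) (pair : X -> Y -> R).
Implicit Types f g : X -> \bar R.

(** Switches between a bound on the conjugate and an affine minorant; it remains true at infinite
    [y]. *)
Lemma EFinB_le (a b : R) (y : \bar R) : (a%:E - y <= b%:E)%E = ((a - b)%:E <= y)%E.
Proof.
case: y => [r||] /=; rewrite ?leey ?leNye//.
by rewrite -EFinB !lee_fin lerBlDr lerBlDl.
Qed.

Lemma biconjugate0_le f : D 0 -> (forall v, V v -> pair 0 v = 0) ->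
  (biconjugate D V pair f 0%R <= f 0%R)%E.
Proof.
move=> D0 p0; apply: ge_ereal_sup => _ [v Vv <-].
rewrite p0// sub0e leeNl; apply: ereal_sup_ubound.
by exists 0 => //; rewrite p0// sub0e.
Qed.

Lemma le_biconjugate f g z : (forall z, D z -> (f z <= g z)%E) ->
  (biconjugate D V pair f z <= biconjugate D V pair g z)%E.
Proof.
move=> fg; apply: ge_ereal_sup => _ [v Vv <-]; apply: le_ereal_sup_tmp.
exists ((pair z v)%:E - conjugate D pair g v)%E; first by exists v.
apply: leeB => //; apply: ge_ereal_sup => _ [y Dy <-]; apply: le_ereal_sup_tmp.
by exists ((pair y v)%:E - f y)%E; [exists y|apply: leeB => //; exact: fg].
Qed.

End biconjugates.

(** * Affine minorants of the two value functions *)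

Section value_functions.
Context {d : measure_display} {Omega : measurableType d} {R : realType}.
Variables (P : probability Omega R) (T : nat) (n : 'I_T.+1 -> nat).
Variable F : 'I_T.+1 -> set (set Omega).
Local Notation N := (\sum_(t < T.+1) n t)%N.
Local Notation tau := (@tagnat.sig1 T.+1 n).
Local Notation Linf := (@Lp d Omega R P +oo%E N).
Variable h : 'rV[R]_N -> Omega -> \bar R.
Hypothesis hF : filtration F.
Hypothesis hN : normal_integrand h.
Hypothesis Eh_proper : proper_on (Lp P +oo%E) (Eh P h).
Implicit Types (x y z p : Omega -> 'rV[R]_N).
Local Notation L1 u := (P.-integrable setT (EFin \o u)).
Local Notation E u := (Rintegral P setT u).

Lemma phi_le_phi_tilde z : (phi P F h z <= phi_tilde P F h z)%E.
Proof. by apply: ereal_inf_le_tmp => _ [x [ax _] <-]; exists x. Qed.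

Lemma adapted_inf0 : adapted_inf P F (0 : Omega -> 'rV[R]_N).
Proof. by split; [exact: adapted0|exact: Linf0]. Qed.

Lemma phi_tilde_le_Eh z : (phi_tilde P F h z <= Eh P h z)%E.
Proof.
apply: ereal_inf_lbound; exists 0; first exact: adapted_inf0.
by rewrite add0r.
Qed.

(** Bounded adapted processes form a linear space, so translating by one of them only reparametrises
    the infimum. *)
Lemma phi_tilde_translate (a : R) x z : adapted_inf P F x ->
  (phi_tilde P F h (a *: x + z)%R <= phi_tilde P F h z)%E.
Proof.
move=> [ax bx]; apply: le_ereal_inf_tmp => _ [y [ay by_] <-].
apply: ereal_inf_lbound; exists ((- a) *: x + y).
  by split; [exact: adapted_lin|exact: Linf_lin].
by congr (Eh P h _); rewrite scaleNr addrACA addNr add0r.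
Qed.

(** Along the direction [x] the function [phi_tilde] cannot increase, whereas its affine minorant
    would be unbounded above if [l x] were nonzero. *)
Lemma vanish_on_adapted (l : (Omega -> 'rV[R]_N) -> R) (c : R) z1 :
  (forall (a : R) x y, Linf x -> Linf y -> l (a *: x + y) = a * l x + l y) ->
  (forall z, Linf z -> ((l z - c)%:E <= phi_tilde P F h z)%E) ->
  Linf z1 -> (phi_tilde P F h z1 < +oo)%E ->
  forall x, adapted_inf P F x -> l x = 0.
Proof.
move=> ll lc Lz1 z1y x ax; apply/eqP; apply: contraT => lx0.
have Lx : Linf x by case: ax.
have z1f : phi_tilde P F h z1 \is a fin_num.
  by rewrite fin_numElt z1y (lt_le_trans _ (lc z1 Lz1))// ltNyr.
pose b := fine (phi_tilde P F h z1).
(* The multiple of [x] is such that the minorant takes the value [b + 1], while [phi_tilde] stays at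
   most [b]. *)
have := lc _ (Linf_lin ((b - l z1 + c + 1) / l x) Lx Lz1).
move=> /le_trans/(_ (phi_tilde_translate _ _ ax)).
rewrite ll// divfK// -(fineK z1f) lee_fin -/b.
lra.
Qed.

Lemma dual_bound_row (p : 'I_N -> Omega -> R) (c : R) :
  (forall i, L1 (p i)) -> orthogonal_to_adapted P tau F p ->
  (forall z, bounded_row z ->
     ((\sum_i E (fun w => p i w * z w 0 i) - c)%:E <= Eh P h z)%E) ->
  forall z, Linf z ->
    ((pairing P z (fun w => \row_i p i w) - c)%:E <= phi P F h z)%E.
Proof.
move=> ip op pc z Lz; apply: le_ereal_inf_tmp => _ [x /adaptedP ax <-].
have pE i : (fun w => (\row_i p i w) 0 i) = p i by apply/funext => w; rewrite mxE.
have ip' i : L1 (fun w => (\row_i p i w) 0 i) by rewrite pE.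
rewrite pairingE//.
rewrite (eq_bigr (fun i => E (fun w => p i w * z w 0 i))); last first.
  by move=> i _; apply: E_ext => w; rewrite mxE.
have /LinfP[mz _] := Lz.
(* Properness supplies the reference point that replaces [x + z] where the latter is large. *)
have [_ [z0 Lz0 Ez0]] := Eh_proper.
have [y0 by0 zy0] := Linf_bounded_version Lz0.
apply: (dual_bound_unbounded hF hN _ by0 _ ip op pc) => //.
- by move=> y by_; apply: Eh_proper.1; exact: bounded_row_Linf.
- have /LinfP[mz0 _] := Lz0.
  rewrite -(Eh_ae hN mz0 (bounded_row_measurable by0) zy0).
  by rewrite lt_neqAle Ez0 leey.
- by move=> i; have := L1_mul_Linf i ip' Lz; rewrite (_ : (fun w => _) = fun w => p i w * z w 0 i)//;
     apply/funext => w; rewrite mxE.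
Qed.

(** The dual element is already a density, and its orthogonality to bounded adapted processes is
    extended to arbitrary ones. This makes each subgradient of [phi_tilde] at the origin one of
    [phi]. *)
Lemma dual_bound_L1 p (c : R) z1 : Lp P 1%E p ->
  Linf z1 -> (phi_tilde P F h z1 < +oo)%E ->
  (forall z, Linf z -> ((pairing P z p - c)%:E <= phi_tilde P F h z)%E) ->
  forall z, Linf z -> ((pairing P z p - c)%:E <= phi P F h z)%E.
Proof.
have [sF FM _] := hF => /L1_rowP ip Lz1 z1y pc z Lz.
have pl (a : R) x y : Linf x -> Linf y ->
    pairing P (a *: x + y) p = a * pairing P x p + pairing P y p.
  move=> Lx Ly; rewrite !pairingE//; last exact: Linf_lin.
  rewrite mulr_sumr -big_split; apply: eq_bigr => i _ /=.
  have [ix iy] := (L1_mul_Linf i ip Lx, L1_mul_Linf i ip Ly).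
  rewrite -EZ// -ED//; last exact: L1Z.
  by apply: E_ext => w; rewrite !mxE; ring.
have p0 := vanish_on_adapted pl pc Lz1 z1y.
have -> : p = (fun w => \row_i p w 0 i) by apply/funext => w; apply/rowP => i; rewrite mxE.
apply: (@dual_bound_row (fun i w => p w 0 i) c) => //.
- move=> i y my yM.
  have by_ : bounded_measurable y.
    by split => //; exact: (measurable_wrt_measurable (FM _) my).
  rewrite -[RHS](p0 (coord_row i y)); last first.
    split; first exact: adapted_coord_row.
    exact/bounded_row_Linf/bounded_coord_row.
  by rewrite pairing_coord_row.
- move=> y by_; have Ly := bounded_row_Linf P by_.
  rewrite -(pairingE ip Ly).
  exact: le_trans (pc y Ly) (phi_tilde_le_Eh y).
Qed.

Hypothesis h_condexp : forall z, Linf z -> (Eh P h z < +oo)%E ->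
  forall t : 'I_T.+1, exists zhat : Omega -> 'rV[R]_N,
    [/\ Linf zhat, (Eh P h zhat < +oo)%E
      & forall s : 'I_T.+1, (s <= t)%N ->
          condexp_eq P (F t) (block z s) (block zhat s)].

(** The constant [c] survives unchanged, so conjugate values and subgradients transfer exactly. The
    point [z1] is there to make [v] vanish on bounded adapted processes. *)
Lemma dual_bound_strong (v : (Omega -> 'rV[R]_N) -> R) (c : R) z1 : Linf_dual P v ->
  Linf z1 -> (phi_tilde P F h z1 < +oo)%E ->
  (forall z, Linf z -> ((v z - c)%:E <= phi_tilde P F h z)%E) ->
  exists2 p, Lp P 1%E p &
    forall z, Linf z -> ((pairing P z p - c)%:E <= phi P F h z)%E.
Proof.
have [sF FM _] := hF => dv Lz1 z1y vc.
have v0 := vanish_on_adapted dv.1 vc Lz1 z1y.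
have [||i|i y my yM|y by_|p [ip op pc]] := @eliminate_singular_part _ _ _ P T N tau F hF h hN
    _ _ c (fun i f => v (coord_row i f)).
- by move=> y by_; apply: Eh_proper.1; exact: bounded_row_Linf.
- move=> z bz Ez t.
  have [zh [Lzh Ezh zhP]] := h_condexp (bounded_row_Linf P bz) Ez t.
  have [y by_ zy] := Linf_bounded_version Lzh.
  have /LinfP[mzh _] := Lzh.
  exists y; split => //.
    by rewrite -(Eh_ae hN mzh (bounded_row_measurable by_) zy).
  move=> i it; have := condexp_eq_cond_exp hF bz (zhP _ it).
  by move=> H; apply: filterS2 H zy => w -> ->.
- exact: Linf_dual_coord.
- apply: v0; split; first exact: adapted_coord_row.
  apply/bounded_row_Linf/bounded_coord_row; split => //.
  exact: (measurable_wrt_measurable (FM _) my).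
- rewrite -(Linf_dual_sum dv by_).
  exact: le_trans (vc _ (bounded_row_Linf P by_)) (phi_tilde_le_Eh y).
exists (fun w => \row_i p i w); last exact: dual_bound_row.
apply/L1_rowP => i; rewrite (_ : (fun w => _) = p i)//.
by apply/funext => w; rewrite mxE.
Qed.

End value_functions.

(** * Comparison of the closures and subdifferentials at the origin *)

Theorem theorem4 (d : measure_display) (Omega : measurableType d) (R : realType)
    (P : probability Omega R) (T : nat) (n : 'I_T.+1 -> nat)
    (F : 'I_T.+1 -> set (set Omega))
    (h : 'rV[R]_(\sum_(t < T.+1) n t) -> Omega -> \bar R)
    (hF : filtration F)
    (h_normal : normal_integrand h)
    (h_convex : convex_integrand h)
    (phi0_fin : phi P F h 0 \is a fin_num)
    (Eh_proper : proper_on (Lp P +oo%E) (Eh P h))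
    (h_condexp : forall z : Omega -> 'rV[R]_(\sum_(t < T.+1) n t),
       Lp P +oo%E z -> (Eh P h z < +oo)%E ->
       forall t : 'I_T.+1,
       exists zhat : Omega -> 'rV[R]_(\sum_(t < T.+1) n t),
         [/\ Lp P +oo%E zhat, (Eh P h zhat < +oo)%E
           & forall s : 'I_T.+1, (s <= t)%N ->
               condexp_eq P (F t) (block z s) (block zhat s)]) :
  (proper_on (Lp P +oo%E) (phi_tilde P F h) ->
   strongly_closed_origin P (phi_tilde P F h) ->
     closed_origin P (phi P F h) /\ phi P F h 0 = cl P (phi_tilde P F h) 0)
  /\
  (strongly_subdifferentiable_origin P (phi_tilde P F h) ->
     subdiff_origin P (phi P F h) = subdiff_origin P (phi_tilde P F h) /\
     subdiff_origin P (phi P F h) !=set0).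
Proof.
have L0 := Linf0 (m := (\sum_(t < T.+1) n t)%N) P.
have pt := phi_le_phi_tilde P F h.
split.
  move=> [ptNy [z1 Lz1 z1y]] sc.
  have z1lty : (phi_tilde P F h z1 < +oo)%E by rewrite lt_neqAle z1y leey.
  (* Each strong dual element with finite conjugate is matched by a density whose conjugate for
     [phi] is no larger. *)
  have le1 : (phi_tilde P F h 0%R <= cl P (phi P F h) 0%R)%E.
    rewrite [leLHS]sc; apply: ge_ereal_sup => _ [v dv <-].
    rewrite /eval_pairing (Linf_dual0 dv) sub0e.
    set cj := conjugate _ _ _ _.
    have vub z : Lp P +oo%E z -> ((v z)%:E - phi_tilde P F h z <= cj)%E.
      by move=> Lz; apply: ereal_sup_ubound; exists z.
    clearbody cj; case: cj vub => [c||] vub.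
    - have [p Lp1 pc] := dual_bound_strong hF h_normal Eh_proper h_condexp dv Lz1 z1lty
        (fun z Lz => etrans (esym (EFinB_le (v z) c _)) (vub z Lz)).
      apply: le_ereal_sup_tmp; exists ((pairing P 0%R p)%:E -
        conjugate (Lp P +oo%E) (pairing P) (phi P F h) p)%E; first by exists p.
      rewrite pairing0 sub0e leeN2; apply: ge_ereal_sup => _ [z Lz <-].
      by rewrite EFinB_le; exact: pc.
    - by rewrite leNye.
    (* A conjugate equal to [-oo] would force [phi_tilde z1 = +oo]. *)
    - have := vub z1 Lz1; rewrite leeNy_eq.
      have := ptNy _ Lz1; move: z1y; by case: (phi_tilde P F h z1).
  have le2 : (cl P (phi P F h) 0%R <= phi P F h 0%R)%E.
    by apply: biconjugate0_le => // p _; exact: pairing0.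
  have le3 : (cl P (phi_tilde P F h) 0%R <= phi_tilde P F h 0%R)%E.
    by apply: biconjugate0_le => // p _; exact: pairing0.
  have le4 : (cl P (phi P F h) 0%R <= cl P (phi_tilde P F h) 0%R)%E.
    by apply: le_biconjugate => z _; exact: pt.
  (* The chain from [phi 0] up to [phi_tilde 0], to [cl phi 0] and back to [phi 0] closes, and
     [cl phi_tilde 0] lies between [cl phi 0] and [phi_tilde 0]. *)
  split; apply/eqP; rewrite eq_le.
    by rewrite (le_trans (pt 0) le1) le2.
  by rewrite (le_trans (pt 0) (le_trans le1 le4)) (le_trans le3 (le_trans le1 le2)).
move=> [v [dv pf vsub]].
have pfE := fineK pf; set b := fine _ in pfE.
have p0y : (phi_tilde P F h 0%R < +oo)%E by rewrite -pfE ltry.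
(* A subgradient is an affine minorant with [c = - phi_tilde 0]; at [z = 0] the resulting bound on
   [phi] reads [phi_tilde 0 <= phi 0]. *)
have [|p Lp1 pc] := @dual_bound_strong _ _ _ P T n F h hF h_normal Eh_proper h_condexp v (- b) 0 dv L0 p0y.
  by move=> z Lz; rewrite opprK addrC EFinD pfE; exact: vsub.
have p0E : phi P F h 0 = phi_tilde P F h 0.
  apply/eqP; rewrite eq_le pt -pfE.
  by have := pc 0 L0; rewrite pairing0 sub0r opprK.
split; last first.
  exists p; split => //.
  by move=> z Lz; rewrite p0E -pfE -EFinD addrC -[b]opprK; exact: pc.
(* One inclusion holds because [phi <= phi_tilde] with equality at the origin; the other applies the
   density case of the dual bound to [q] itself. *)
apply/seteqP; split => q [Lq _ qsub].
  split => //.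
  by move=> z Lz; rewrite -p0E (le_trans (qsub z Lz)).
split => //.
move=> z Lz; rewrite p0E -pfE -EFinD addrC -[b]opprK.
apply: (dual_bound_L1 hF h_normal Eh_proper Lq L0 p0y _ Lz) => y Ly.
by rewrite opprK addrC EFinD pfE; exact: qsub.
Qed.
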